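(* Let $0<R<\infty$ and let $B_R(0)=\{x\in\mathbb{R}^3 : |x|<R\}$. Then the space $H^1(B_R(0))\cap L^1(B_R(0))$, equipped with the norm $\|\phi\|_{H^1\cap L^1}:=\sqrt{\|\phi\|_{H^1}^2+\|\phi\|_{L^1}^2}$, where $\|\phi\|_{H^1}^2=\|\phi\|_{L^2}^2+\|\nabla\phi\|_{L^2}^2$ and all norms are taken over $B_R(0)$, is a uniformly convex, reflexive Banach space.
   Context: $H^1=W^{1,2}$ denotes the Sobolev space. Functions are real-valued. A Banach space $(X,\|\cdot\|)$ is uniformly convex if for every $\varepsilon>0$ there exists $\delta>0$ such that for all $x,y\in X$ with $\|x\|=\|y\|=1$: $\|x-y\|>\varepsilon$ implies $\left\|\frac{x+y}{2}\right\|<1-\delta$. *)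

(* Defs.v *)
From HB Require Import structures.
From mathcomp Require Import all_boot all_order all_algebra.
From mathcomp Require Import all_classical all_reals all_analysis.
From mathcomp Require Import measurable_realfun ring_quotient generic_quotient.

Set Implicit Arguments.
Unset Strict Implicit.
Unset Printing Implicit Defensive.
Import Order.TTheory GRing.Theory Num.Theory.
Import numFieldNormedType.Exports.
Local Open Scope classical_set_scope.
Local Open Scope ring_scope.
Local Open Scope quotient_scope.

Section Norms.
Context (R : realType).

Record is_norm (V : lmodType R) (N : V -> R) : Prop := IsNorm {
  is_norm_triangle : forall x y, N (x + y) <= N x + N y;
  is_norm_scale : forall (a : R) x, N (a *: x) = `|a| * N x;
  is_norm_eq0 : forall x, N x = 0 -> x = 0
}.

(* The space V equipped with the norm N, as a library normed module. *)
Definition normed (V : lmodType R) (N : V -> R) (h : is_norm N) : Type := V.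

HB.instance Definition _ V N (h : @is_norm V N) := GRing.Lmodule.on (normed h).
HB.instance Definition _ V N (h : @is_norm V N) :=
  @Lmodule_isNormed.Build R (normed h) N
    (is_norm_triangle h) (is_norm_scale h) (is_norm_eq0 h).

(* The axiom of the library's complete uniform spaces: with it, X is a
   completeNormedModType, i.e. a Banach space. *)
Definition complete_space (X : normedModType R) : Prop :=
  forall F : set_system X, ProperFilter F -> cauchy F -> cvg F.

Definition uniformly_convex (X : normedModType R) : Prop :=
  forall e : R, 0 < e -> exists2 d : R, 0 < d &
    forall x y : X, `|x| = 1 -> `|y| = 1 -> e < `|x - y| ->
      `|2^-1 *: (x + y)| < 1 - d.

End Norms.

Section Dual.
Context (R : realType) (X : normedModType R).

(* Topological dual of X, with the operator norm. *)
Definition continuous_linear : {pred X -> R^o} :=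
  fun f => `[< linear f /\ continuous f >].

Lemma continuous_linear_submod_closed : submod_closed continuous_linear.
Proof.
split.
  apply/asboolP; split; first by move=> a x y /=; rewrite scaler0 addr0.
  exact: cst_continuous.
move=> a f g /asboolP[lf cf] /asboolP[lg cg]; apply/asboolP; split.
  move=> b x y; rewrite !fctE lf lg /= !scalerDr -!addrA; congr (_ + _).
    by rewrite !scalerA mulrC.
  by rewrite addrCA.
by move=> x; apply: cvgD; [exact: cvgZl_tmp (cf x) | exact: cg].
Qed.

HB.instance Definition _ := GRing.isSubmodClosed.Build R (X -> R^o)
  continuous_linear continuous_linear_submod_closed.

Record dual := Dual {
  dual_fun :> X -> R^o;
  _ : dual_fun \in continuous_linear
}.

HB.instance Definition _ := [isSub for dual_fun].
HB.instance Definition _ := [Choice of dual by <:].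
HB.instance Definition _ := [SubChoice_isSubLmodule of dual by <:].

Definition dual_norm (f : dual) : R :=
  sup [set `|f x| | x in [set x : X | `|x| <= 1]].

Lemma dual_linear (f : dual) : linear f.
Proof. by case: f => f /= /asboolP[]. Qed.

Lemma dual_continuous (f : dual) : continuous f.
Proof. by case: f => f /= /asboolP[]. Qed.

Let dual_normP (f : dual) : has_sup [set `|f x| | x in [set x : X | `|x| <= 1]].
Proof.
split; first by exists `|f 0|, 0 => //=; rewrite normr0.
pose L := GRing.isLinear.Build _ _ _ _ f (@dual_linear f).
pose g : {linear X -> R^o} := HB.pack (f : X -> R^o) L.
have /linear_bounded_continuous/bounded_funP/(_ 1)[M HM] : continuous g.
  exact: dual_continuous.
by exists M => _ /= [x x1 <-]; exact: HM.
Qed.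

Let le_dual_norm (f : dual) x : `|x| <= 1 -> `|f x| <= dual_norm f.
Proof.
by move=> x1; apply: ub_le_sup; [exact: (dual_normP f).2 | exists x].
Qed.

Let dual_norm_le (f : dual) M :
  (forall x, `|x| <= 1 -> `|f x| <= M) -> dual_norm f <= M.
Proof.
move=> fM; apply: ge_sup; first exact: (dual_normP f).1.
by move=> _ /= [x x1 <-]; exact: fM.
Qed.

Let dual_norm_triangle (f g : dual) :
  dual_norm (f + g) <= dual_norm f + dual_norm g.
Proof.
apply: dual_norm_le => x x1; apply: (le_trans (ler_normD _ _)).
by apply: lerD; exact: le_dual_norm.
Qed.

Let dual_norm_scale_le (a : R) (f : dual) :
  dual_norm (a *: f) <= `|a| * dual_norm f.
Proof.
apply: dual_norm_le => x x1; rewrite [_ x]/(a * f x) normrM.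
by rewrite ler_wpM2l// le_dual_norm.
Qed.

Let dual_norm_scale (a : R) (f : dual) :
  dual_norm (a *: f) = `|a| * dual_norm f.
Proof.
apply/eqP; rewrite eq_le dual_norm_scale_le /=.
have [->|a0] := eqVneq a 0.
  rewrite normr0 mul0r; apply: le_trans (@le_dual_norm _ 0 _) => //.
  by rewrite normr0.
rewrite -ler_pdivlMl ?normr_gt0// -normfV.
by rewrite -{1}[f]scale1r -(mulVf a0) -scalerA.
Qed.

Let dual_norm_eq0 (f : dual) : dual_norm f = 0 -> f = 0.
Proof.
move=> f0; apply/val_inj/funext => x /=.
have [->|x0] := eqVneq x 0.
  by have := dual_linear f (-1) 0 0; rewrite scaler0 addr0 scaleN1r addNr.
have := @le_dual_norm f (`|x|^-1 *: x).
rewrite normrZ normfV normr_id mulVf ?normr_eq0// lexx f0 => /(_ isT).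
have := dual_linear f (`|x|^-1) x 0.
have f00 : f 0 = 0.
  by have := dual_linear f (-1) 0 0; rewrite scaler0 addr0 scaleN1r addNr.
rewrite f00 !addr0 => ->; rewrite normr_le0 scaler_eq0 invr_eq0 normr_eq0.
by rewrite (negbTE x0) => /eqP.
Qed.

HB.instance Definition _ := @Lmodule_isNormed.Build R dual dual_norm
  dual_norm_triangle dual_norm_scale dual_norm_eq0.

End Dual.

(* Surjectivity of the canonical embedding of X into its bidual. *)
Definition reflexive_space (R : realType) (X : normedModType R) : Prop :=
  forall Phi : dual (dual X), exists x : X, forall f : dual X, Phi f = f x.

Section Sobolev.
Context (R : realType).

(* The three-dimensional space as a measurable space; for topology and
   differentiation the same carrier is used as the normed module R * R * R,
   whose norm is the maximum norm (hence the separate Euclidean enorm). *)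
Definition R3 : Type :=
  (measurableTypeR R * measurableTypeR R * measurableTypeR R)%type.

HB.instance Definition _ := Measurable.on R3.

Definition lebesgue3 : {measure set R3 -> \bar R} :=
  (@lebesgue_measure R \x @lebesgue_measure R \x @lebesgue_measure R)%E.

Definition enorm (x : R * R * R) : R :=
  Num.sqrt (x.1.1 ^+ 2 + x.1.2 ^+ 2 + x.2 ^+ 2).

Definition oball (r : R) : set (R * R * R) := [set x | enorm x < r].

Lemma measurable_oball (r : R) : measurable (oball r : set R3).
Proof.
have m1 : measurable_fun [set: R3] (fun x => x.1.1 : R).
  exact: (measurableT_comp measurable_fst measurable_fst).
have m2 : measurable_fun [set: R3] (fun x => x.1.2 : R).
  exact: (measurableT_comp measurable_snd measurable_fst).
have m3 : measurable_fun [set: R3] (fun x => x.2 : R).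
  exact: measurable_snd.
have me : measurable_fun [set: R3] (enorm : R3 -> R).
  apply: (@measurableT_comp _ _ _ _ _ _ (Num.sqrt : R -> R)).
    exact: continuous_measurable_fun (@sqrt_continuous R).
  by do 2?[apply: measurable_funD]; exact: measurable_funX.
by rewrite -[X in measurable X]setTI; exact: measurable_fun_ltr.
Qed.

(* Lebesgue measure concentrated on the ball: functions on the ball, modulo
   equality almost everywhere, are represented by Borel functions on the whole
   space modulo equality almost everywhere for this measure. *)
Definition ball_measure (r : R) : {measure set R3 -> \bar R} :=
  mrestr lebesgue3 (measurable_oball r).

Definition basis3 (i : 'I_3) : R * R * R :=
  ((i == 0 :> nat)%:R, (i == 1 :> nat)%:R, (i == 2 :> nat)%:R).

Definition partial (i : 'I_3) (f : R * R * R -> R) : R * R * R -> R :=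
  fun x => 'D_(basis3 i) f x.

Fixpoint is_Ck (k : nat) (f : R * R * R -> R) : Prop :=
  continuous f /\
  if k is k'.+1 then
    forall i, (forall x, derivable f x (basis3 i)) /\ is_Ck k' (partial i f)
  else True.

Lemma open_measurable3 (U : set (R * R * R)) : open U ->
  measurable (U : set R3).
Proof.
move=> oU.
pose B (q : rat * rat * rat * rat) : set (R * R * R) :=
  ball ((ratr q.1.1.1, ratr q.1.1.2, ratr q.1.2) : R * R * R) (ratr q.2 : R).
pose F q : set R3 := if asbool (B q `<=` U) then B q else set0.
have -> : (U : set R3) = \bigcup_q F q.
  apply/seteqP; split=> [x Ux|x [q _]]; last first.
    by rewrite /F; case: ifPn => // /asboolP; apply.
  have [e /= e0 eU] : exists2 e : R, 0 < e & ball x e `<=` U.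
    by have /nbhs_ballP[e] := open_nbhs_nbhs (conj oU Ux); exists e.
  have [d /andP[d0 de]] : exists d : rat, 0 < (ratr d : R) < e / 2.
    have := @rat_in_itvoo R 0 (e / 2); rewrite divr_gt0// => /(_ isT)[d].
    by rewrite in_itv/=; exists d.
  have approx (y : R) : exists q : rat, `|ratr q - y| < ratr d.
    have := @rat_in_itvoo R (y - ratr d) (y + ratr d).
    have yd : y - ratr d < y + ratr d by rewrite ltrBlDr -addrA ltrDl addr_gt0.
    move=> /(_ yd)[q]; rewrite in_itv/= => qP; exists q.
    by rewrite ltr_norml ltrBrDr ltrBlDr addrC (addrC (ratr d)).
  have [q1 h1] := approx x.1.1; have [q2 h2] := approx x.1.2.
  have [q3 h3] := approx x.2.
  exists (q1, q2, q3, d) => //; rewrite /F; case: asboolP => [_|].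
    by split; [split|].
  move=> BU; exfalso; apply: BU => y [[/= y1 y2] y3]; apply: eU.
  have tri (a b c : R) : `|b - a| < ratr d -> `|b - c| < ratr d -> `|a - c| < e.
    move=> ha hb; rewrite (_ : a - c = (a - b) + (b - c)); last first.
      by rewrite addrA subrK.
    rewrite (le_lt_trans (ler_normD _ _))// [e]splitr ltrD//.
      by rewrite distrC (lt_trans ha).
    by rewrite (lt_trans hb).
  by split; [split|]; rewrite /ball/=; [apply: tri h1 y1|apply: tri h2 y2|
    apply: tri h3 y3].
apply: countable_bigcupT_measurable => [|q]; first exact: countableP.
rewrite /F; case: ifP => // _.
have -> : (B q : set R3) =
    (ball (ratr q.1.1.1 : R) (ratr q.2) `*` ball (ratr q.1.1.2 : R) (ratr q.2))
    `*` ball (ratr q.1.2 : R) (ratr q.2) by [].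
by apply: measurableX; [apply: measurableX|];
  apply: open_measurable; exact: ball_open.
Qed.

Lemma continuous_measurable3 (f : R * R * R -> R) : continuous f ->
  measurable_fun [set: R3] (f : R3 -> R).
Proof.
move=> /continuousP cf; apply: (measurability _ (RGenOpens.measurableE R)).
move=> _ [_ [a [b ->] <-]]; rewrite setTI; apply: open_measurable3.
exact/cf/interval_open.
Qed.
(* Elements of C_c^oo of the ball, extended by zero to the whole space. *)
Definition is_test_function (r : R) (f : R * R * R -> R) : Prop :=
  [/\ forall k, is_Ck k f,
      compact (closure [set x | f x != 0]) &
      closure [set x | f x != 0] `<=` oball r].

Definition is_weak_partial (r : R) (i : 'I_3) (f g : R3 -> R) : Prop :=
  forall phi, is_test_function r phi ->
    \int[ball_measure r]_x (f x * partial i phi x) =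
    - \int[ball_measure r]_x (g x * phi x).


Section H1L1.
Variable r : R.
Local Notation mu := (ball_measure r).

Let box : set (R * R * R) :=
  (`[- `|r|, `|r|] `*` `[- `|r|, `|r|]) `*` `[- `|r|, `|r|].

Let oball_box : oball r `<=` box.
Proof.
move=> x xr.
have xr' : x.1.1 ^+ 2 + x.1.2 ^+ 2 + x.2 ^+ 2 <= `|r| ^+ 2.
  rewrite -(@ler_sqrt _ _ (`|r|^+2)) ?exprn_ge0// sqrtr_sqr normr_id.
  by rewrite (le_trans (ltW xr))// ler_norm.
have aux (a : R) : a ^+ 2 <= `|r| ^+ 2 -> `[- `|r|, `|r|]%classic a.
  move=> h; rewrite /= in_itv/= -ler_norml -(@ler_pXn2r _ 2)// ?nnegrE//.
  by rewrite -normrX ger0_norm// sqr_ge0.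
have [[s1 s2] s3] := (sqr_ge0 x.1.1, sqr_ge0 x.1.2, sqr_ge0 x.2).
split; [split|]; apply: aux; apply: (le_trans _ xr').
- by rewrite -addrA lerDl addr_ge0.
- by rewrite addrAC lerDr addr_ge0.
- by rewrite lerDr addr_ge0.
Qed.

Lemma ball_measure_fin : mu [set: R3] \is a fin_num.
Proof.
rewrite ge0_fin_numE//; apply: (@le_lt_trans _ _ (lebesgue3 box)).
  rewrite /ball_measure/= /mrestr setTI; apply: le_measure; last exact: oball_box.
  - by rewrite inE; exact: measurable_oball.
  - by rewrite inE; apply: measurableX => //; exact: measurableX.
rewrite /lebesgue3 /box [ltLHS]product_measure1E//; last exact: measurableX.
rewrite [X in (X * _)%E]product_measure1E//=.
rewrite !lebesgue_measure_itv/=.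
by case: ifP => _; rewrite ?mule0 ?mul0e// -?EFinB -!EFinM ltry.
Qed.

Lemma continuous_Lfun2 (f : R * R * R -> R) : continuous f -> f \in Lfun mu 2%:E.
Proof.
move=> cf; have mf := continuous_measurable3 cf.
have cK : compact box.
  by apply: compact_setX; [apply: compact_setX|]; exact: segment_compact.
have [M HM] : exists M : R, forall x, box x -> `|f x| <= M.
  have : compact (f @` box).
    by apply: continuous_compact => //; exact: continuous_subspaceT.
  move=> /compact_bounded[M [_ HM]]; exists (M + 1) => x Kx.
  by apply: (HM (M + 1)); [rewrite ltrDl|exists x].
rewrite inE; apply/andP; split; rewrite inE//= /finite_norm unlock /Lnorm.
rewrite poweR_lty//; apply: (@le_lt_trans _ _ (\int[mu]_x (`|M| `^ 2)%:E)%E); last first.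
  by rewrite integral_cst// ltey_eq fin_numM// ball_measure_fin.
apply: ae_ge0_le_integral => //.
- by move=> x _; rewrite lee_fin powR_ge0.
- apply/measurable_EFinP.
  apply: (@measurableT_comp _ _ _ _ _ _ (@powR R ^~ 2)) => //.
  exact: measurableT_comp.
- exists (~` (oball r) : set R3); split.
  + by apply: measurableC; exact: measurable_oball.
  + by rewrite /ball_measure/= /mrestr setICl measure0.
  + move=> x /= nP xr; apply: nP => _; rewrite lee_fin ge0_ler_powR//.
    by rewrite (le_trans (HM _ (oball_box xr)))// ler_norm.
Qed.

Lemma continuous_mul_integrable (f phi : R * R * R -> R) :
  f \in Lfun mu 2%:E -> continuous phi ->
  mu.-integrable setT (EFin \o (fun x => f x * phi x)).
Proof.
move=> Lf cphi; apply/Lfun1_integrable.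
by apply: Lfun2_mul_Lfun1 => //; exact: continuous_Lfun2.
Qed.

Lemma is_weak_partial_linear (i : 'I_3) (a : R) (f1 g1 f2 g2 : R3 -> R) :
  f1 \in Lfun mu 2%:E -> g1 \in Lfun mu 2%:E ->
  f2 \in Lfun mu 2%:E -> g2 \in Lfun mu 2%:E ->
  is_weak_partial r i f1 g1 -> is_weak_partial r i f2 g2 ->
  is_weak_partial r i (a *: (f1 : R3 -> R^o) + f2) (a *: (g1 : R3 -> R^o) + g2).
Proof.
move=> Lf1 Lg1 Lf2 Lg2 w1 w2 phi tphi.
have cphi : continuous phi by have [/(_ 0%N)[]] := tphi.
have cdphi : continuous (partial i phi).
  by have [/(_ 1%N)[_ /(_ i)[_ []]]] := tphi.
have key (f g psi : R * R * R -> R) : f \in Lfun mu 2%:E ->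
    g \in Lfun mu 2%:E -> continuous psi ->
    \int[mu]_x ((a *: (f : R3 -> R^o) + g) x * psi x) =
    a * \int[mu]_x (f x * psi x) + \int[mu]_x (g x * psi x).
  move=> Lf Lg cpsi.
  rewrite -RintegralZl//; last exact: continuous_mul_integrable.
  rewrite -RintegralD//; last 2 first.
  - exact: (integrableZl measurableT a (continuous_mul_integrable Lf cpsi)).
  - exact: continuous_mul_integrable.
  by apply: eq_Rintegral => x _; rewrite !fctE mulrDl mulrA.
by rewrite !key// w1// w2// opprD mulrN.
Qed.

(* H1 = W^{1,2}: square-integrable functions all of whose first-order weak
   partial derivatives exist and are square-integrable. *)
Definition H1 : {pred R3 -> R^o} := fun f =>
  `[< f \in Lfun mu 2%:E /\
      forall i : 'I_3, exists2 g, g \in Lfun mu 2%:E & is_weak_partial r i f g >].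

(* For f in H1 this is a weak partial derivative of f; it is unique only up to
   a null set of the ball. *)
Definition weak_partial (i : 'I_3) (f : R3 -> R) : R3 -> R :=
  xget (cst 0)
    [set g : R3 -> R | g \in Lfun mu 2%:E /\ is_weak_partial r i f g].

(* Pointwise Euclidean length of the weak gradient. *)
Definition weak_gradient_norm (f : R3 -> R) : R3 -> R :=
  fun x => Num.sqrt (\sum_(i < 3) weak_partial i f x ^+ 2).

Definition L_norm (p : R) (f : R3 -> R) : R := fine ('N[mu]_(p%:E)[EFin \o f])%E.

Definition H1_norm (f : R3 -> R) : R :=
  Num.sqrt (L_norm 2 f ^+ 2 + L_norm 2 (weak_gradient_norm f) ^+ 2).

Definition in_H1L1 : {pred R3 -> R^o} := [predI H1 & Lfun mu 1].

Lemma Lfun_lin (p : \bar R) (a : R) (f g : R3 -> R^o) : (1 <= p)%E ->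
  f \in Lfun mu p -> g \in Lfun mu p -> (a *: f + g : R3 -> R^o) \in Lfun mu p.
Proof.
move=> p1 Lf Lg.
by have [_] := Lfun_submod_closed mu p1; exact.
Qed.

Lemma in_H1L1_submod_closed : submod_closed in_H1L1.
Proof.
have L0 p : (1 <= p)%E -> (0 : R3 -> R^o) \in Lfun mu p.
  by move=> p1; have [] := Lfun_submod_closed mu p1.
have l12 : (1 <= 2%:E :> \bar R)%E by rewrite lee_fin ler1n.
split.
  apply/andP; split; last exact: L0.
  apply/asboolP; split; first exact: L0.
  move=> i; exists 0; first exact: L0.
  move=> phi tphi.
  have z (psi : R3 -> R) : \int[mu]_x ((0 : R3 -> R^o) x * psi x) = 0.
    by rewrite /Rintegral integral0_eq// => x _; rewrite [_ * _]mul0r.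
  by rewrite !z oppr0.
move=> a f g /andP[/asboolP[Lf wf] L1f] /andP[/asboolP[Lg wg] L1g].
apply/andP; split; last exact: Lfun_lin.
apply/asboolP; split; first exact: Lfun_lin.
move=> i; have [f' Lf' wf'] := wf i; have [g' Lg' wg'] := wg i.
exists (a *: (f' : R3 -> R^o) + g'); first exact: Lfun_lin.
exact: is_weak_partial_linear.
Qed.

HB.instance Definition _ := GRing.isSubmodClosed.Build R (R3 -> R^o)
  in_H1L1 in_H1L1_submod_closed.

Record H1L1fun := MkH1L1fun {
  H1L1fun_val :> R3 -> R^o;
  _ : H1L1fun_val \in in_H1L1
}.

HB.instance Definition _ := [isSub for H1L1fun_val].
HB.instance Definition _ := [Choice of H1L1fun by <:].
HB.instance Definition _ := [SubChoice_isSubLmodule of H1L1fun by <:].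

Definition ae_zero : {pred H1L1fun} := fun f =>
  `[< {ae mu, forall x, f x = 0} >].

Lemma ae_zero_submod_closed : submod_closed ae_zero.
Proof.
split; first by apply/asboolP; exact: aeW.
move=> a f g /asboolP f0 /asboolP g0; apply/asboolP.
by apply: filterS2 f0 g0 => x /= fx gx; rewrite [LHS]/(a *: (f x : R^o) + g x) fx gx scaler0; exact: (addr0 (0 : R)).
Qed.

HB.instance Definition _ := GRing.isSubmodClosed.Build R H1L1fun
  ae_zero ae_zero_submod_closed.

(* The quotient of the function space by equality almost everywhere. *)
Definition H1L1 : Type := Quotient.quot ae_zero.

HB.instance Definition _ := GRing.Zmodule.on H1L1.
HB.instance Definition _ := EqQuotient.on H1L1.

Definition H1L1_scale (a : R) (u : H1L1) : H1L1 := \pi_H1L1 (a *: repr u).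

Lemma pi_scale (a : R) (f : H1L1fun) :
  H1L1_scale a (\pi_H1L1 f) = \pi_H1L1 (a *: f).
Proof.
apply/eqP; rewrite -Quotient.idealrBE -scalerBr; apply: rpredZ.
by rewrite Quotient.idealrBE reprK.
Qed.

Let scaleA (a b : R) (u : H1L1) :
  H1L1_scale a (H1L1_scale b u) = H1L1_scale (a * b) u.
Proof. by rewrite -[u]reprK (pi_scale b (repr u)) (pi_scale a (b *: repr u))
  (pi_scale (a * b) (repr u)) scalerA. Qed.

Let scale1 : left_id 1 H1L1_scale.
Proof. by move=> u; rewrite -[u]reprK pi_scale scale1r. Qed.

Let pi_add (f g : H1L1fun) : \pi_H1L1 (f + g) = \pi_H1L1 f + \pi_H1L1 g.
Proof. exact: (@Quotient.pi_add _ ae_zero f g). Qed.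

Let scaleDr : right_distributive H1L1_scale +%R.
Proof.
move=> a u v; rewrite -[u]reprK -[v]reprK.
by rewrite -pi_add !pi_scale -pi_add scalerDr.
Qed.

Let scaleDl (u : H1L1) : {morph H1L1_scale^~ u : a b / a + b}.
Proof. by move=> a b; rewrite -[u]reprK !pi_scale -pi_add scalerDl. Qed.

HB.instance Definition _ := GRing.Zmodule_isLmodule.Build R H1L1
  scaleA scale1 scaleDr scaleDl.

(* The choice of representative is immaterial: these norms only depend
   on the class modulo equality almost everywhere on the ball. *)
Definition H1L1_norm (u : H1L1) : R :=
  Num.sqrt (H1_norm (repr u) ^+ 2 + L_norm 1 (repr u) ^+ 2).

End H1L1.
End Sobolev.

(* Main.v *)
Require Import Defs.
From HB Require Import structures.
From mathcomp Require Import all_boot all_order all_algebra.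
From mathcomp Require Import all_classical all_reals all_analysis.
From mathcomp Require Import measurable_realfun ring_quotient generic_quotient.
From mathcomp Require Import ring lra.

(** The square of the norm is B(u, u) + N(u)^2, where B is the inner product of
    H^1 and N the L^1 norm. On a ball the measure is finite, so Cauchy-Schwarz
    gives N(u)^2 <= C B(u, u): the norm is equivalent to the Hilbert norm of
    B, and what has to be shown follows from that, for any vector space with
    such a B and N ([hilbertian_banach]).
    - Uniform convexity: for unit vectors x and y, the parallelogram identity
      for B and the convexity of N^2 give
      |(x + y)/2|^2 <= 1 - B(x - y, x - y)/4, and B(x - y, x - y) is at least
      |x - y|^2/(1 + C).
    - Reflexivity: the Riesz representation theorem holds for B
      ([hilbertian_riesz]: minimize B(x, x) - 2 f(x)), and bounded functionals
      for the norm are bounded for B. A functional Phi on the dual, composed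
      with v |-> B(-, v), is therefore represented by some x, and Phi is then
      evaluation at x because every functional has the form B(-, v).
    - Completeness: it is enough to treat sequences that are Cauchy for B at a
      geometric rate.

    Two facts about Sobolev functions enter. Weak derivatives are unique up to
    null sets, which makes B well defined and bilinear: this is the
    du Bois-Reymond lemma ([test_integral0_ae]). If g integrates to zero
    against every test function, approximating the indicators of boxes inside
    the ball by products of functions exp(-c/t) with c -> 0 shows that g
    integrates to zero over these boxes, hence over all their measurable
    subsets by a monotone class argument, and so g = 0 almost everywhere.
    Secondly B is complete: L^2 is complete ([L2_complete], by almost
    everywhere convergence of fast Cauchy sequences and Fatou's lemma), and
    the integration by parts identity defining weak derivatives passes to
    L^2 limits ([is_weak_partial_closed]). *)

Set Implicit Arguments.
Unset Strict Implicit.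
Unset Printing Implicit Defensive.
Import Order.TTheory GRing.Theory Num.Theory.
Import numFieldNormedType.Exports.
Local Open Scope classical_set_scope.
Local Open Scope ring_scope.

(** * Quadratic inequalities *)

Lemma le_of_sqr (R : realDomainType) (a b : R) :
  0 <= b -> a ^+ 2 <= b ^+ 2 -> a <= b.
Proof. by move=> b0 ab; rewrite leNgt; apply/negP => ba; nra. Qed.

Lemma sqr_le_sqr (R : realDomainType) (a b : R) :
  0 <= a -> a <= b -> a ^+ 2 <= b ^+ 2.
Proof. by move=> a0 ab; nra. Qed.

Lemma le_norm_of_sqr (R : realDomainType) (a b : R) :
  0 <= b -> a ^+ 2 <= b ^+ 2 -> `|a| <= b.
Proof.
by move=> b0 ab; apply: le_of_sqr => //; rewrite real_normK ?num_real.
Qed.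

(** Evaluate the quadratic at its minimum - b / a; when a = 0 it is affine, and
    an affine function bounded below is constant. *)
Lemma discriminant_le0 (R : realFieldType) (a b c : R) : 0 <= a ->
  (forall t, 0 <= a * t ^+ 2 + 2 * b * t + c) -> b ^+ 2 <= a * c.
Proof.
move=> a0 H; have [az|an] := eqVneq a 0.
  have [->|bn] := eqVneq b 0; first by rewrite expr0n/= az mul0r.
  have := H (- (c + 1) / (2 * b)); rewrite az mul0r add0r.
  have -> : 2 * b * (- (c + 1) / (2 * b)) = - (c + 1) by field.
  lra.
have ap : 0 < a by rewrite lt_def an.
have := H (- b / a).
have -> : a * (- b / a) ^+ 2 + 2 * b * (- b / a) + c = (a * c - b ^+ 2) / a.
  by field.
by rewrite pmulr_lge0 ?invr_gt0// subr_ge0.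
Qed.

(** * Norms dominated by an inner product *)

Section Hilbertian.
Context (R : realType) (V : lmodType R).
Context (B : V -> V -> R) (N : V -> R) (C : R).
(** The example to have in mind is B = the inner product of H^1 and N = the norm
    of L^1. Completeness is only asked for sequences that are Cauchy at a
    geometric rate, and a constant K may be lost in the rate of convergence. *)
Hypothesis B_sym : forall x y, B x y = B y x.
Hypothesis B_lin : forall a x y z, B (a *: x + y) z = a * B x z + B y z.
Hypothesis B_ge0 : forall x, 0 <= B x x.
Hypothesis B_eq0 : forall x, B x x = 0 -> x = 0.
Hypothesis N_ge0 : forall x, 0 <= N x.
Hypothesis N_triangle : forall x y, N (x + y) <= N x + N y.
Hypothesis N_scale : forall a x, N (a *: x) = `|a| * N x.
Hypothesis N_dom : forall x, N x ^+ 2 <= C * B x x.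
Hypothesis B_complete : forall u : nat -> V,
  (forall n m, (n <= m)%N -> B (u m - u n) (u m - u n) <= 4^-1 ^+ n) ->
  exists v K, forall n, B (u n - v) (u n - v) <= K * 4^-1 ^+ n.

Let M x := Num.sqrt (B x x + N x ^+ 2).

Lemma bilin0l z : B 0 z = 0.
Proof. by have := B_lin 1 0 0 z; rewrite scaler0 add0r; lra. Qed.

Lemma bilinDl x y z : B (x + y) z = B x z + B y z.
Proof. by rewrite -[x]scale1r B_lin scale1r mul1r. Qed.

Lemma bilinZl a x z : B (a *: x) z = a * B x z.
Proof. by rewrite -[_ *: _]addr0 B_lin bilin0l addr0. Qed.

Lemma bilinNl x z : B (- x) z = - B x z.
Proof. by rewrite -scaleN1r bilinZl mulN1r. Qed.

Lemma bilinDr x y z : B z (x + y) = B z x + B z y.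
Proof. by rewrite !(B_sym z) bilinDl. Qed.

Lemma bilinZr a x z : B z (a *: x) = a * B z x.
Proof. by rewrite !(B_sym z) bilinZl. Qed.

Lemma bilinNr x z : B z (- x) = - B z x.
Proof. by rewrite !(B_sym z) bilinNl. Qed.

Let bilinE := (bilinDl, bilinDr, bilinNl, bilinNr, bilinZl, bilinZr).

Lemma cauchy_schwarz x y : B x y ^+ 2 <= B x x * B y y.
Proof.
apply: discriminant_le0 => // t; have := B_ge0 (t *: x + y).
by rewrite !bilinE (B_sym y x); lra.
Qed.

Let Msq x : M x ^+ 2 = B x x + N x ^+ 2.
Proof. by rewrite sqr_sqrtr// addr_ge0// sqr_ge0. Qed.

Let M_ge0 x : 0 <= M x. Proof. exact: sqrtr_ge0. Qed.

(** The norm is the Euclidean norm of the pair of seminorms (sqrt B(x, x), N x), so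
    its triangle inequality follows from those of the two seminorms and of the
    Euclidean plane; the latter is the final identity of squares. *)
Lemma hilbertian_triangle x y : M (x + y) <= M x + M y.
Proof.
apply: le_of_sqr; first exact: addr_ge0.
rewrite Msq !bilinE (B_sym y x) sqrrD !Msq.
have Nxy : N (x + y) ^+ 2 <= (N x + N y) ^+ 2.
  exact: sqr_le_sqr.
suff : B x y + N x * N y <= M x * M y.
  by move: Nxy; rewrite sqrrD; lra.
have [b0|b0] := leP (B x y + N x * N y) 0.
  by apply: le_trans b0 _; rewrite mulr_ge0.
apply: le_of_sqr; first exact: mulr_ge0.
rewrite exprMn !Msq.
set s := Num.sqrt (B x x); set t := Num.sqrt (B y y).
have s0 : 0 <= s by exact: sqrtr_ge0.
have t0 : 0 <= t by exact: sqrtr_ge0.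
have sE : B x x = s ^+ 2 by rewrite sqr_sqrtr.
have tE : B y y = t ^+ 2 by rewrite sqr_sqrtr.
have bst : B x y <= s * t.
  apply: le_of_sqr; first exact: mulr_ge0.
  by rewrite exprMn -sE -tE cauchy_schwarz.
apply: (@le_trans _ _ ((s * t + N x * N y) ^+ 2)).
  by apply: sqr_le_sqr; [exact: ltW|rewrite lerD2r].
rewrite sE tE -subr_ge0.
have -> : (s ^+ 2 + N x ^+ 2) * (t ^+ 2 + N y ^+ 2) - (s * t + N x * N y) ^+ 2
  = (s * N y - t * N x) ^+ 2 by ring.
exact: sqr_ge0.
Qed.

Lemma hilbertian_is_norm : is_norm M.
Proof.
split; first exact: hilbertian_triangle.
- move=> a x; rewrite /M !bilinE N_scale exprMn real_normK ?num_real//.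
  by rewrite -sqrtr_sqr -sqrtrM ?sqr_ge0//; congr Num.sqrt; ring.
- move=> x /eqP; rewrite sqrtr_eq0 => h; apply: B_eq0.
  by have := B_ge0 x; have := sqr_ge0 (N x); lra.
Qed.

Local Notation X := (normed hilbertian_is_norm).

Let normE (x : X) : `|x| = M x. Proof. by []. Qed.

Let B_le_norm (x : X) : B x x <= `|x| ^+ 2.
Proof. by rewrite normE Msq lerDl sqr_ge0. Qed.

Let norm_le_B (x : X) : `|x| ^+ 2 <= (1 + C) * B x x.
Proof. by rewrite normE Msq mulrDl mul1r lerD2l. Qed.

Let C1 : 0 < 1 + `|C|. Proof. by rewrite ltr_pwDl. Qed.

Let norm_le_B' (x : X) : `|x| ^+ 2 <= (1 + `|C|) * B x x.
Proof.
by apply: le_trans (norm_le_B x) _; rewrite ler_wpM2r// lerD2l ler_norm.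
Qed.


Let pow4E n : 4^-1 ^+ n = (2^-1 ^+ n) ^+ 2 :> R.
Proof. by rewrite -exprM mulnC exprM; congr (_ ^+ n); field. Qed.

Let half_pow_small (e : R) : 0 < e -> exists n, 2^-1 ^+ n < e.
Proof.
move=> e0; have : (fun n => (2^-1 : R) ^+ n) @ \oo --> (0 : R).
  by apply: cvg_expr; rewrite ger0_norm// invf_lt1// ltr1n.
move/cvgr_lt => /(_ _ e0) [n _ /(_ n)/= h]; exists n; exact: h.
Qed.

(** A Cauchy filter contains balls of radius 2^-n/4; their centers form a sequence
    to which the completeness of B applies, and the limit of the centers is the
    limit of the filter. *)
Lemma hilbertian_complete : complete_space X.
Proof.
move=> F FF /cauchyP Fc.
have pos n : 0 < 4^-1 * 2^-1 ^+ n :> R by rewrite mulr_gt0// exprn_gt0.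
have /choice[c Fcn] : forall n, exists x : X, F (ball x (4^-1 * 2^-1 ^+ n)).
  by move=> n; exact: Fc.
have close n m : (n <= m)%N -> `|c m - c n : X| <= 2^-1 ^+ n.
  move=> nm; have [z []] := filter_ex (filterI (Fcn n) (Fcn m)).
  rewrite -!ball_normE/= => zn zm.
  have -> : c m - c n = (c m - z) - (c n - z).
    by rewrite opprB addrA subrK.
  rewrite (le_trans (ler_normB _ _))//.
  have : 2^-1 ^+ m <= 2^-1 ^+ n :> R by rewrite ler_wiXn2l// invf_le1// ler1n.
  have : 0 < 2^-1 ^+ n :> R by rewrite exprn_gt0.
  by move: zn zm; lra.
have [n m nm|v [L Bv]] := @B_complete c.
  apply: le_trans (B_le_norm (c m - c n)) _.
  by rewrite pow4E sqr_le_sqr// close.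
apply/cvg_ex; exists (v : X); apply/cvg_ballP => e e0.
have L0 : 0 <= L by have := Bv 0; rewrite expr0 mulr1; exact: le_trans.
pose K := Num.sqrt ((1 + `|C|) * L).
have K2 : K ^+ 2 = (1 + `|C|) * L by rewrite sqr_sqrtr// mulr_ge0// ltW.
have [|n nsmall] := @half_pow_small (e / (4^-1 + K)).
  by rewrite divr_gt0// ltr_wpDr// sqrtr_ge0.
apply: filterS (Fcn n) => z.
rewrite -!ball_normE/= => cz.
have cv : `|(v : X) - c n| <= K * 2^-1 ^+ n.
  rewrite distrC; apply: le_of_sqr.
    by rewrite mulr_ge0 ?sqrtr_ge0 ?exprn_ge0.
  rewrite exprMn -pow4E K2 -mulrA.
  apply: (le_trans (norm_le_B' (c n - v : X))).
  by apply: ler_wpM2l; [exact: ltW|exact: Bv].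
have -> : (v : X) - z = (v - c n) + (c n - z) by rewrite addrA subrK.
rewrite (le_lt_trans (ler_normD _ _))//.
move: nsmall; rewrite ltr_pdivlMr; last by rewrite ltr_wpDr// sqrtr_ge0.
by move: cv cz; lra.
Qed.

(** By the parallelogram identity for B and the convexity of N^2, the midpoint m of
    two unit vectors x and y has |m|^2 <= 1 - B(x - y, x - y) / 4; moreover
    B(x - y, x - y) >= |x - y|^2 / (1 + |C|). *)
Lemma hilbertian_uniformly_convex : uniformly_convex X.
Proof.
move=> e e0; pose k := e ^+ 2 / (4 * (1 + `|C|)).
have k0 : 0 < k by rewrite divr_gt0 ?exprn_gt0 ?mulr_gt0.
(* 1 - k <= (1 - k / 2)^2 *)
exists (k / 2) => [|x y x1 y1 exy]; first by rewrite divr_gt0.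
have kB : k < 4^-1 * B (x - y) (x - y).
  rewrite /k ltr_pdivrMr ?mulr_gt0//.
  have : e ^+ 2 < `|x - y| ^+ 2.
    by have := ltW exy; nra.
  by have := norm_le_B' (x - y); lra.
have : `|2^-1 *: (x + y)| ^+ 2 < 1 - k.
  rewrite normrZ exprMn normE Msq.
  have := Msq x; have := Msq y; rewrite -!normE x1 y1 => h1 h2.
  have : N (x + y) ^+ 2 <= (N x + N y) ^+ 2.
    exact: sqr_le_sqr.
  rewrite ger0_norm//; move: kB; rewrite !bilinE (B_sym y x).
  by have := sqr_ge0 (N x - N y); rewrite !expr2; lra.
set s := `|_| => sk.
have s0 : 0 <= s by exact: normr_ge0.
have k1 : k < 1 by have := sqr_ge0 s; lra.
rewrite ltNge; apply/negP => ks.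
have k2 : 0 <= 1 - k / 2 by lra.
by have := sqr_le_sqr k2 ks; nra.
Qed.

(** The representing vector minimizes F(x) = B(x, x) - 2 f(x). The parallelogram
    identity makes minimizing sequences Cauchy, and the Euler equation
    B(v, w) = f(w) is the limit of its approximate version along such a
    sequence. *)
Lemma hilbertian_riesz (f : V -> R) (K : R) :
  (forall a x y, f (a *: x + y) = a * f x + f y) ->
  (forall x : X, `|f x| <= K * `|x|) -> exists v, forall w, f w = B v w.
Proof.
move=> f_lin f_bdd.
have f0 : f 0 = 0 by have := f_lin 1 0 0; rewrite scaler0 add0r; lra.
have fD x y : f (x + y) = f x + f y by rewrite -[x]scale1r f_lin scale1r mul1r.
have fZ a x : f (a *: x) = a * f x by rewrite -[_ *: _]addr0 f_lin f0 addr0.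
pose F x := B x x - 2 * f x.
have F_ge x : - (K ^+ 2 * (1 + `|C|)) <= F x.
  have := f_bdd x; rewrite ler_norml => /andP[_].
  have := norm_le_B' x; set n := `|_|; rewrite /F => h1 h2.
  have h3 : n ^+ 2 / (1 + `|C|) <= B x x by rewrite ler_pdivrMr// mulrC.
  (* completing the square in n = |x| *)
  have h4 : 0 <= (n / (1 + `|C|) - K) ^+ 2 * (1 + `|C|).
    by rewrite mulr_ge0 ?sqr_ge0 ?ltW.
  have h5 : (n / (1 + `|C|) - K) ^+ 2 * (1 + `|C|) =
     n ^+ 2 / (1 + `|C|) - 2 * K * n + K ^+ 2 * (1 + `|C|).
    by field; rewrite gt_eqF.
  by lra.
pose m := inf (range F).
have Fhas : has_inf (range F).
  by split; [exists (F 0), 0|exists (- (K ^+ 2 * (1 + `|C|))) => _ [x _ <-]].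
have mF x : m <= F x by apply: ge_inf; [exact: Fhas.2|exists x].
have /choice[u uP] : forall n, exists x, F x <= m + 4^-1 * 4^-1 ^+ n.
  move=> n; have p : 0 < 4^-1 * 4^-1 ^+ n :> R by rewrite mulr_gt0// exprn_gt0.
  by have [_ [x _ <-] /ltW] := inf_adherent p Fhas; exists x.
have [n l nl|v [L Bv]] := @B_complete u.
  have := mF (2^-1 *: (u l + u n)); have := uP l; have := uP n.
  have : 4^-1 ^+ l <= 4^-1 ^+ n :> R by rewrite ler_wiXn2l// invf_le1// ler1n.
  by rewrite /F !bilinE fZ fD (B_sym (u n) (u l)); lra.
have L0 : 0 <= L by have := Bv 0; rewrite expr0 mulr1; exact: le_trans.
exists v => w.
(* the quadratic t |-> F (t w + u n) - m is nonnegative *)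
have euler n : (B (u n) w - f w) ^+ 2 <= B w w * (4^-1 * 4^-1 ^+ n).
  apply: discriminant_le0 => // t.
  have := mF (t *: w + u n); have := uP n.
  by rewrite /F !bilinE f_lin (B_sym w (u n)); lra.
have diff n : (B v w - B (u n) w) ^+ 2 <= B w w * (L * 4^-1 ^+ n).
  have := cauchy_schwarz (u n - v) w; rewrite !bilinE.
  have := Bv n; rewrite !bilinE => h1 h2.
  rewrite -sqrrN opprB; apply: le_trans h2 _.
  by rewrite mulrC ler_wpM2l.
apply/eqP; rewrite eq_sym -subr_eq0; apply/eqP; set d := _ - _.
suff : d ^+ 2 <= 0 by rewrite real_exprn_even_le0 ?num_real//= => /eqP.
rewrite leNgt; apply/negP => d0.
have b0 := B_ge0 w.
have [|n nsmall] := @half_pow_small (d ^+ 2 / (4 * (L + 1) * (B w w + 1))).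
  by rewrite divr_gt0// !mulr_gt0// ltr_wpDl.
move: nsmall; rewrite ltr_pdivlMr ?mulr_gt0 ?ltr_wpDl//.
have : 4^-1 ^+ n <= 2^-1 ^+ n :> R by rewrite lerXn2r ?nnegrE//; lra.
have p4 : 0 < 4^-1 ^+ n :> R by rewrite exprn_gt0.
have : d ^+ 2 <= 2 * (B v w - B (u n) w) ^+ 2 + 2 * (B (u n) w - f w) ^+ 2.
  by rewrite /d; have := sqr_ge0 ((B v w - B (u n) w) - (B (u n) w - f w)); lra.
have := euler n; have := diff n.
set p := 4^-1 ^+ n in p4 *; set q := 2^-1 ^+ n; set b := B w w in b0 *.
move=> h1 h2 h3 h4 h5.
have : 0 <= (q - p) * (4 * (L + 1) * (b + 1)).
  by rewrite mulr_ge0 ?subr_ge0// !mulr_ge0// addr_ge0.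
have : 0 <= p * L by rewrite mulr_ge0// ltW.
have : 0 <= p * b by rewrite mulr_ge0// ltW.
have : 0 <= p * L * b by rewrite !mulr_ge0// ltW.
by move: h1 h2 h3 h5; lra.
Qed.

(** Let J v be the functional B(-, v). The functional v |-> Phi (J v) is bounded, so
    it is B(-, x) for some x; as every f is some J v, this says Phi f = f x. *)
Lemma hilbertian_reflexive : reflexive_space X.
Proof.
have bdd (Y : normedModType R) (f : Y -> R^o) : linear f -> continuous f ->
    exists K, forall x : Y, `|f x| <= K * `|x|.
  move=> fl fc.
  pose L := GRing.isLinear.Build _ _ _ _ f fl.
  pose g : {linear Y -> R^o} := HB.pack (f : Y -> R^o) L.
  have /linear_bounded_continuous/linear_boundedP : continuous g by exact: fc.
  by move=> /pinfty_ex_gt0[K _ HK]; exists K.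
move=> Phi.
have Jin (v : X) : (fun x : X => B x v : R^o) \in @continuous_linear R X.
  apply/asboolP.
  have lin : linear (fun x : X => B x v : R^o) by move=> a x y; rewrite B_lin.
  split=> //.
  pose L := GRing.isLinear.Build _ _ _ _ (fun x : X => B x v : R^o) lin.
  pose g : {linear X -> R^o} := HB.pack (fun x : X => B x v : R^o) L.
  apply: (@bounded_linear_continuous _ _ _ g); apply/bounded_funP => s.
  exists (s * `|v|) => x xs; rewrite /g/=.
  apply: le_norm_of_sqr; first by rewrite mulr_ge0// (le_trans _ xs).
  apply: le_trans (cauchy_schwarz _ _) _.
  rewrite exprMn ler_pM//; apply: le_trans (B_le_norm _) _ => //.
  exact: sqr_le_sqr.
pose J (v : X) : dual X := Dual (Jin v).
have JE v x : J v x = B x v by [].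
have J_lin a v w : J (a *: v + w) = a *: J v + J w.
  apply/val_inj/funext => x /=.
  by rewrite [RHS]/(a * B x v + B x w) bilinDr bilinZr.
have J_norm v : `|J v| <= `|v|.
  apply: ge_sup; first by exists `|J v 0|, 0 => //=; rewrite normr0.
  move=> _ [x /= x1 <-]; apply: le_norm_of_sqr => //.
  apply: le_trans (cauchy_schwarz _ _) _.
  rewrite -[leRHS]mul1r ler_pM//; apply: le_trans (B_le_norm _) _ => //.
  by rewrite -[leRHS](expr1n _ 2) sqr_le_sqr.
have [KPhi HPhi] := bdd _ _ (@dual_linear _ _ Phi) (@dual_continuous _ _ Phi).
have [a v w|v|x Hx] := @hilbertian_riesz (fun v => Phi (J v)) `|KPhi|.
- by rewrite J_lin dual_linear.
- apply: le_trans (HPhi _) _; apply: le_trans (ler_wpM2r _ (ler_norm _)) _ => //.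
  by rewrite ler_wpM2l.
exists x => f.
have [Kf Hf] := bdd _ _ (@dual_linear _ _ f) (@dual_continuous _ _ f).
have [a v w||v Hv] := @hilbertian_riesz f Kf.
- by rewrite dual_linear.
- exact: Hf.
have -> : f = J v by apply/val_inj/funext => w /=; rewrite B_sym; exact: Hv.
by rewrite Hx JE.
Qed.

Theorem hilbertian_banach (nrm : V -> R) :
  (forall x, nrm x = Num.sqrt (B x x + N x ^+ 2)) ->
  exists h : is_norm nrm,
    [/\ complete_space (normed h),
        uniformly_convex (normed h) &
        reflexive_space (normed h)].
Proof.
move=> nrmE; have -> : nrm = M by apply/funext.
by exists hilbertian_is_norm; split;
  [exact: hilbertian_complete|exact: hilbertian_uniformly_convex|
   exact: hilbertian_reflexive].
Qed.

End Hilbertian.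

(** * Flat functions *)

Section FlatFunction.
Context (R : realType).
Implicit Types (p : {poly R}) (c t : R).

(** The functions p(1/t) exp(-c/t), extended by zero to t <= 0. Allowing a
    polynomial p makes the family stable under differentiation, so that
    smoothness follows from the existence of one derivative. *)
Definition flat c p : R -> R :=
  fun t => if 0 < t then p.[t^-1] * expR (- (c * t^-1)) else 0.

Definition flat_deriv c p : {poly R} := 'X ^+ 2 * (c *: p - p^`()).

Lemma flat_scale c p (w t : R) : flat c (w *: p) t = w * flat c p t.
Proof.
by rewrite /flat; case: ifP => _; rewrite ?mulr0// hornerZ mulrA.
Qed.

Lemma horner_le_pow p : exists2 A : R, 0 <= A &
  forall s, 1 <= s -> `|p.[s]| <= A * s ^+ size p.
Proof.
exists (\sum_(i < size p) `|p`_i|); first exact: sumr_ge0.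
move=> s s1; rewrite horner_coef (le_trans (ler_norm_sum _ _ _))//.
rewrite mulr_suml ler_sum// => i _.
rewrite normrM ler_wpM2l// normrX ger0_norm ?(le_trans _ s1)//.
by rewrite ler_weXn2l// ltnW.
Qed.

(** With s = 1/t and n the size of p, p(s) is at most A s^n, while exp(c s) is at
    least (c s)^(n + 2) / (n + 2)!. The bound in t^2 makes the function
    differentiable at 0. *)
Lemma flat_bound c p : 0 < c -> exists2 K : R, 0 <= K &
  forall t, t <= 1 -> `|flat c p t| <= K * t ^+ 2.
Proof.
move=> c0; have [A A0 HA] := horner_le_pow p.
pose n := (size p).+1; pose L : R := n.+1`!%:R / c ^+ n.+1.
have L0 : 0 <= L by rewrite divr_ge0 ?exprn_ge0// ltW.
exists (A * L) => [|t t1]; first by rewrite mulr_ge0.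
rewrite /flat; case: ifPn => [t0|_]; last first.
  by rewrite normr0 mulr_ge0 ?sqr_ge0// mulr_ge0.
have s1 : 1 <= t^-1 by rewrite invf_ge1.
have s0 : 0 < t^-1 by rewrite invr_gt0.
rewrite normrM (ger0_norm (expR_ge0 _)).
apply: (@le_trans _ _ (A * t^-1 ^+ size p * (L * t ^+ n.+1))).
  rewrite ler_pM ?HA ?expR_ge0//.
  rewrite expRN -[leRHS]invrK lef_pV2 ?posrE ?expR_gt0//; last first.
    by rewrite invr_gt0 mulr_gt0 ?exprn_gt0// divr_gt0 ?exprn_gt0.
  have ct0 : 0 <= c * t^-1 by rewrite mulr_ge0 ?ltW.
  apply: le_trans (expR_ge1Dxn n ct0); rewrite /L invfM invf_div exprMn exprVn mulrAC.
  by rewrite lerDr.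
have -> : t ^+ n.+1 = t ^+ size p * t ^+ 2 by rewrite -exprD addn2.
have tK : t^-1 ^+ size p * t ^+ size p = 1.
  by rewrite -exprMn mulVf ?gt_eqF// expr1n.
rewrite [leLHS](_ : _ = A * L * t ^+ 2 * (t^-1 ^+ size p * t ^+ size p)).
  by rewrite tK mulr1.
by clearbody L; ring.
Qed.

Lemma is_derive_flat c p t : 0 < c ->
  is_derive t 1 (flat c p) (flat c (flat_deriv c p) t).
Proof.
move=> c0; have [t0|t0|->] := ltgtP t 0.
- apply: (@near_eq_is_derive _ _ _ (cst 0)).
    near=> x; rewrite /flat ifN// -leNgt ltW//; near: x; exact: lt_nbhsl.
  by rewrite /flat ifN -?leNgt ?ltW//; exact: is_derive_cst.
- apply: (@near_eq_is_derive _ _ _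
      ((horner p \o GRing.inv) * (expR \o (fun x => - (c * x^-1))))).
    by near=> x; rewrite /flat ifT//; near: x; exact: lt_nbhsr.
  have tn0 : t != 0 by rewrite gt_eqF.
  have dV : is_derive t 1 (@GRing.inv R) (- t ^- 2).
    have dt : is_derive t 1 (id : R -> R) 1 by exact: is_derive_id.
    by have := is_deriveV tn0 dt; rewrite scaler1.
  have dp := is_derive1_comp (is_derive_poly p t^-1) dV.
  have dce : is_derive t 1 (fun x : R => - (c * x^-1)) (c * t ^- 2).
    have := is_deriveN (is_deriveZ c dV).
    by rewrite scalerN opprK.
  have de := @is_derive1_comp _ expR (fun x => - (c * x^-1)) t _ _
    (is_derive_expR (- (c * t^-1))) dce.
  apply: (is_derive_eq (is_deriveM dp de)).
  rewrite /flat ifT//= /flat_deriv !hornerE /= -!exprVn.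
  by rewrite -[_ *: _]/(_ * _) -[X in _ + X]/(_ * _); ring.
have [K K0 HK] := flat_bound p c0.
have f0 q : flat c q 0 = 0 by rewrite /flat ltxx.
have : (fun h : R => h^-1 *: ((flat c p \o shift 0) (h *: 1) - flat c p 0))
    @ 0^' --> (0 : R).
  apply/cvgr0Pnorm_le => e e0; near=> h.
  rewrite f0 subr0 /= addr0 scaler1 -[_ *: _]/(_ * _) normrM normfV.
  have hn0 : h != 0 by near: h; exact: nbhs_dnbhs_neq.
  have h1 : `|h| <= 1.
    near: h; apply: dnbhs0_le; exact: ltr01.
  have he : `|h| <= e / (K + 1).
    by near: h; apply: dnbhs0_le; rewrite divr_gt0// ltr_wpDl.
  rewrite ler_pdivrMl ?normr_gt0//.
  apply: (le_trans (HK _ (le_trans (ler_norm _) h1))).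
  rewrite -[X in K * X](@real_normK) ?num_real// expr2 mulrCA ler_wpM2l//.
  move: he; rewrite ler_pdivlMr ?ltr_wpDl//; have := normr_ge0 h; nra.
move=> lim0; apply: DeriveDef; first by apply/cvg_ex; exists 0.
by rewrite f0; exact: cvg_lim lim0.
Unshelve. all: by end_near. Qed.

Lemma continuous_flat c p : 0 < c -> continuous (flat c p).
Proof.
move=> c0 t; apply/differentiable_continuous/derivable1_diffP.
by have [] := is_derive_flat p t c0.
Qed.

Lemma flat1_ge0 c t : 0 <= flat c 1 t.
Proof. by rewrite /flat; case: ifP => // _; rewrite hornerC mul1r expR_ge0. Qed.

Lemma flat1_le1 c t : 0 < c -> flat c 1 t <= 1.
Proof.
rewrite /flat; case: ifP => // t0 c0; rewrite hornerC mul1r expR_le1.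
by rewrite oppr_le0 ltW// divr_gt0.
Qed.

Lemma flat1_neq0 c t : flat c 1 t != 0 -> 0 < t.
Proof. by rewrite /flat; case: ifP => //; rewrite eqxx. Qed.

(** As c tends to 0 the functions exp(-c/t) approach the indicator of the positive
    half-line; this is what turns test functions into boxes. *)
Lemma cvg_flat1 t : (fun n : nat => flat n.+1%:R^-1 1 t) @ \oo -->
  ((0 < t)%R%:R : R).
Proof.
rewrite /flat; case: (0 < t); last exact: cvg_cst.
have -> : (true%:R : R) = 1 * expR (- (0 * t^-1)).
  by rewrite mul0r oppr0 expR0 mul1r.
under eq_fun do rewrite hornerC.
apply: cvgM; first exact: cvg_cst.
apply: continuous_cvg; first exact: continuous_expR.
by apply: cvgN; apply: cvgM; [exact: cvg_harmonic|exact: cvg_cst].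
Qed.

End FlatFunction.

(** * Test functions supported in boxes *)

Section TestFunctions.
Context (R : realType).
Local Notation V := (R * R * R)%type.
Implicit Types (f g : V -> R) (k : nat).

Lemma is_Ck_continuous k f : is_Ck k f -> continuous f.
Proof. by case: k => [|k] []. Qed.

Lemma is_CkS k f : is_Ck k.+1 f -> is_Ck k f.
Proof.
elim: k f => [|k IH] f; first by case.
by move=> [cf H]; split=> // i; have [df Hf] := H i; split=> //; exact: IH.
Qed.

Lemma is_CkD k f g : is_Ck k f -> is_Ck k g -> is_Ck k (f \+ g).
Proof.
elim: k f g => [|k IH] f g.
  by move=> [cf _] [cg _]; split=> // x; apply: cvgD; [exact: cf|exact: cg].
move=> [cf Hf] [cg Hg]; split.
  by move=> x; apply: cvgD; [exact: cf|exact: cg].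
move=> i; have [df Hf'] := Hf i; have [dg Hg'] := Hg i; split.
  by move=> x; apply: derivableD.
suff -> : partial i (f \+ g) = partial i f \+ partial i g by exact: IH.
by apply/funext => x; exact: deriveD.
Qed.

Lemma is_CkM k f g : is_Ck k f -> is_Ck k g -> is_Ck k (f \* g).
Proof.
elim: k f g => [|k IH] f g.
  by move=> [cf _] [cg _]; split=> // x; apply: cvgM; [exact: cf|exact: cg].
move=> Ckf Ckg; move: (Ckf) (Ckg) => [cf Hf] [cg Hg]; split.
  by move=> x; apply: cvgM; [exact: cf|exact: cg].
move=> i; have [df Hf'] := Hf i; have [dg Hg'] := Hg i; split.
  by move=> x; apply: derivableM.
have -> : partial i (f \* g) = (f \* partial i g) \+ (g \* partial i f).
  by apply/funext => x; exact: deriveM.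
by apply: is_CkD; apply: IH => //; exact: is_CkS.
Qed.

(** If h is affine with linear part w, the partial derivatives of [flat c p \o h]
    are again of this form, with w i *: flat_deriv c p instead of p. *)
Lemma is_Ck_flat_affine k (c : R) (p : {poly R}) (h : V -> R) (w : 'I_3 -> R) :
  0 < c -> continuous h ->
  (forall i (s : R) x, h (s *: basis3 R i + x) = s * w i + h x) ->
  is_Ck k (flat c p \o h).
Proof.
move=> c0 ch haff; have cont q : continuous (flat c q \o h).
  by move=> x; apply: continuous_comp; [exact: ch|exact: continuous_flat].
elim: k p => [|k IH] p; split=> // i.
have D x : is_derive x (basis3 R i) (flat c p \o h)
    ((flat c (w i *: flat_deriv c p) \o h) x).
  have dfl : differentiable (flat c p) (h x).
    by apply/derivable1_diffP; have [] := is_derive_flat p (h x) c0.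
  (* both difference quotients are the same function of s *)
  have E : (fun s : R => s^-1 *: (((flat c p \o h) \o shift x) (s *: basis3 R i)
       - (flat c p \o h) x)) =
     (fun s : R => s^-1 *: ((flat c p \o shift (h x)) (s *: w i)
       - flat c p (h x))).
    by apply/funext => s /=; rewrite haff.
  apply: DeriveDef; first by rewrite /derivable E; exact: diff_derivable.
  rewrite /derive E -[LHS]/('D_(w i) (flat c p) (h x)) deriveE//.
  rewrite -[w i]mulr1 -[w i * 1]/(w i *: 1) linearZ/= -deriveE//.
  have [_ ->] := is_derive_flat p (h x) c0.
  by rewrite -[_ *: 1]/(w i * 1) mulr1 flat_scale.
split; first by move=> x; have [] := D x.
suff -> : partial i (flat c p \o h) = flat c (w i *: flat_deriv c p) \o h.
  exact: IH.
by apply/funext => x; have [_] := D x.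
Qed.

Definition obox (a b : V) : set V :=
  (`]a.1.1, b.1.1[ `*` `]a.1.2, b.1.2[) `*` `]a.2, b.2[.

Definition cbox (a b : V) : set V :=
  (`[a.1.1, b.1.1] `*` `[a.1.2, b.1.2]) `*` `[a.2, b.2].

Definition flat2 (c s t y : R) : R := flat c 1 (y - s) * flat c 1 (t - y).

Definition box_bump (c : R) (a b : V) : V -> R := fun x =>
  flat2 c a.1.1 b.1.1 x.1.1 * flat2 c a.1.2 b.1.2 x.1.2 * flat2 c a.2 b.2 x.2.

Lemma flat2_ge0 c s t y : 0 <= flat2 c s t y.
Proof. by rewrite mulr_ge0// flat1_ge0. Qed.

Lemma flat2_le1 c s t y : 0 < c -> flat2 c s t y <= 1.
Proof. by move=> c0; rewrite mulr_ile1// ?flat1_ge0// flat1_le1. Qed.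

Lemma flat2_neq0 c s t y : flat2 c s t y != 0 -> s < y < t.
Proof.
by rewrite mulf_eq0 negb_or => /andP[/flat1_neq0 + /flat1_neq0];
  rewrite !subr_gt0 => -> ->.
Qed.

Lemma cvg_flat2 s t y : (fun n : nat => flat2 n.+1%:R^-1 s t y) @ \oo -->
  ((s < y < t)%R%:R : R).
Proof.
have -> : ((s < y < t)%R%:R : R) = (0 < y - s)%R%:R * (0 < t - y)%R%:R.
  by rewrite !subr_gt0 -natrM mulnb.
by apply: cvgM; exact: cvg_flat1.
Qed.

Lemma box_bump_ge0 c a b x : 0 <= box_bump c a b x.
Proof. by apply: mulr_ge0; [apply: mulr_ge0|]; exact: flat2_ge0. Qed.

Lemma box_bump_le1 c a b x : 0 < c -> box_bump c a b x <= 1.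
Proof.
move=> c0; apply: mulr_ile1; rewrite ?flat2_ge0 ?flat2_le1//.
  by apply: mulr_ge0; exact: flat2_ge0.
by apply: mulr_ile1; rewrite ?flat2_ge0 ?flat2_le1.
Qed.

Lemma oboxE a b x : obox a b x <->
  [&& a.1.1 < x.1.1 < b.1.1, a.1.2 < x.1.2 < b.1.2 & a.2 < x.2 < b.2].
Proof.
rewrite /obox /= !in_itv/=; split; first by move=> [[-> ->] ->].
by move=> /and3P[-> -> ->].
Qed.

Lemma box_bump_neq0 c a b x : box_bump c a b x != 0 -> obox a b x.
Proof.
rewrite mulf_eq0 negb_or => /andP[]; rewrite mulf_eq0 negb_or => /andP[].
by move=> /flat2_neq0 h1 /flat2_neq0 h2 /flat2_neq0 h3; apply/oboxE/and3P.
Qed.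

Lemma cvg_box_bump a b x : (fun n : nat => box_bump n.+1%:R^-1 a b x) @ \oo -->
  (\1_(obox a b) x : R).
Proof.
have -> : \1_(obox a b) x = (a.1.1 < x.1.1 < b.1.1)%R%:R *
    (a.1.2 < x.1.2 < b.1.2)%R%:R * (a.2 < x.2 < b.2)%R%:R :> R.
  rewrite indicE -!natrM !mulnb -andbA; congr (nat_of_bool _)%:R.
  by apply/idP/idP => [/set_mem/oboxE|/oboxE/mem_set].
by apply: cvgM; [apply: cvgM|]; exact: cvg_flat2.
Qed.

Let c11 : continuous (fun x : V => x.1.1).
Proof. by move=> x; apply: (@continuous_comp _ _ _ fst fst); exact: cvg_fst. Qed.

Let c12 : continuous (fun x : V => x.1.2).
Proof.
by move=> x; apply: (@continuous_comp _ _ _ fst snd);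
  [exact: cvg_fst|exact: cvg_snd].
Qed.

Let c2 : continuous (fun x : V => x.2).
Proof. by move=> x; exact: cvg_snd. Qed.

Lemma is_Ck_box_bump k c a b : 0 < c -> is_Ck k (box_bump c a b).
Proof.
move=> c0.
have aux (h : V -> R) (w : 'I_3 -> R) s t : continuous h ->
    (forall i (u : R) x, h (u *: basis3 R i + x) = u * w i + h x) ->
    is_Ck k (fun x => flat2 c s t (h x)).
  move=> ch hw; apply: is_CkM.
    apply: (@is_Ck_flat_affine _ _ _ (fun x => h x - s) w) => //.
      by move=> x; apply: cvgB; [exact: ch|exact: cvg_cst].
    by move=> i u x; rewrite hw addrA.
  apply: (@is_Ck_flat_affine _ _ _ (fun x => t - h x) (fun i => - w i)) => //.
    by move=> x; apply: cvgB; [exact: cvg_cst|exact: ch].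
  by move=> i u x; rewrite hw; ring.
apply: is_CkM; first apply: is_CkM.
- exact: (aux _ (fun i => (basis3 R i).1.1)).
- exact: (aux _ (fun i => (basis3 R i).1.2)).
- exact: (aux _ (fun i => (basis3 R i).2)).
Qed.

Lemma closed_cbox a b : closed (cbox a b).
Proof.
by apply: compact_closed; [exact: norm_hausdorff|];
  apply: compact_setX; [apply: compact_setX|]; exact: segment_compact.
Qed.

Lemma box_bump_test_function r c a b : 0 < c -> cbox a b `<=` oball r ->
  is_test_function r (box_bump c a b).
Proof.
move=> c0 abr; have sub : closure [set x | box_bump c a b x != 0] `<=` cbox a b.
  rewrite ((closure_id _).1 (@closed_cbox a b)).
  apply: closureS => x /box_bump_neq0/oboxE/and3P[].
  move=> /andP[p1 p2] /andP[p3 p4] /andP[p5 p6]; split; [split|];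
    by rewrite /= in_itv/= !ltW.
split; first by move=> k; exact: is_Ck_box_bump.
  apply: subclosed_compact sub; first exact: closed_closure.
  by apply: compact_setX; [apply: compact_setX|]; exact: segment_compact.
exact: subset_trans abr.
Qed.

End TestFunctions.

(** * Integrals vanishing on boxes *)

(** The sets A such that the integral over S and the preimage of A vanishes form a
    Dynkin system. Pulling back along h lets the sigma-algebra of a product be
    handled one coordinate at a time. *)
Lemma dynkin_integral0 d d' (T : measurableType d) (T' : measurableType d')
    (R : realType) (mu : {measure set T -> \bar R}) (h : T -> T') (S : set T)
    (f : T -> \bar R) (G : set (set T')) :
  measurable_fun [set: T] h -> measurable S -> mu.-integrable [set: T] f ->
  @measurable _ T' = <<s G >> -> setI_closed G ->
  (\int[mu]_(x in S) f x = 0)%E ->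
  (forall A, G A -> \int[mu]_(x in h @^-1` A `&` S) f x = 0)%E ->
  forall A, measurable A -> (\int[mu]_(x in h @^-1` A `&` S) f x = 0)%E.
Proof.
move=> mh mS fi mG GI S0 G0.
have mpre A : measurable A -> measurable (h @^-1` A).
  by move=> mA; rewrite -[X in measurable X]setTI; exact: mh.
have fiS A : measurable A -> mu.-integrable A f.
  by move=> mA; apply: integrableS fi.
suff H A : <<s G >> A -> (\int[mu]_(x in h @^-1` A `&` S) f x = 0)%E.
  by move=> A mA; apply: H; rewrite -mG.
move: A; apply: (dynkin_induction mG GI) => //.
- by rewrite preimage_setT setTI.
- move=> A mA A0; have mA' := measurableI _ _ (mpre _ mA) mS.
  have mAc := measurableI _ _ (mpre _ (measurableC mA)) mS.
  rewrite -{}S0 -[in RHS](setTI S) -(setUv (h @^-1` A)) setIUl.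
  rewrite integral_setU//.
  + by rewrite A0 add0e.
  + by apply: (measurable_int mu); apply: fiS; exact: measurableU.
  + by apply/disj_setPS => x [[+ _] [+ _]].
- move=> F mF tF F0; rewrite preimage_bigcup setI_bigcupl integral_bigcup.
  + by rewrite eseries0// => k _ _; exact: F0.
  + apply/trivIsetP => i j _ _ ij; rewrite setIACA setIid -preimage_setI.
    by move/trivIsetP : tF => /(_ i j I I ij) ->; rewrite preimage_set0 set0I.
  + by move=> k; apply: measurableI mS; exact: mpre.
  + by apply/fiS/bigcup_measurable => k _; apply: measurableI mS; exact: mpre.
Qed.

Lemma open_itvI_closed (R : realType) : setI_closed (@RGenOpens.G R).
Proof.
move=> _ _ [a [b ->]] [c [d ->]]; exists (Num.max a c), (Num.min b d).
apply/seteqP; split=> x; rewrite /= !in_itv/= gt_max lt_min.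
  by move=> [/andP[-> ->] /andP[-> ->]].
by move=> /andP[/andP[-> ->] /andP[-> ->]].
Qed.

Section BoxesInBall.
Context (R : realType).
Local Notation V := (R * R * R)%type.

Let m1 : measurable_fun [set: R3 R] (fun x => x.1.1 : R).
Proof. exact: (measurableT_comp measurable_fst measurable_fst). Qed.

Let m2 : measurable_fun [set: R3 R] (fun x => x.1.2 : R).
Proof. exact: (measurableT_comp measurable_snd measurable_fst). Qed.

Let m3 : measurable_fun [set: R3 R] (fun x => x.2 : R).
Proof. exact: measurable_snd. Qed.

Lemma measurable_obox (a b : V) : measurable (obox a b : set (R3 R)).
Proof. by apply: measurableX; [apply: measurableX|]. Qed.

(** Intervals are replaced by measurable sets one coordinate at a time; then
    rectangles by measurable sets in the two products. At each stage the
    integral over the whole slab is known to vanish, since intersecting the box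
    with the slab over one of its own sides does not change it. *)
Lemma integral0_obox_measurable (mu : {measure set (R3 R) -> \bar R})
    (a b : V) (f : R3 R -> \bar R) : mu.-integrable [set: R3 R] f ->
  (forall a' b', \int[mu]_(x in obox a' b' `&` obox a b) f x = 0)%E ->
  forall A, measurable A -> (\int[mu]_(x in A `&` obox a b) f x = 0)%E.
Proof.
move=> fi f0; pose Q : set (R3 R) := obox a b.
have mQ : measurable Q := measurable_obox a b.
pose X1 (A : set R) : set (R3 R) := (fun x => x.1.1 : R) @^-1` A.
pose X2 (A : set R) : set (R3 R) := (fun x => x.1.2 : R) @^-1` A.
pose X3 (A : set R) : set (R3 R) := (fun x => x.2 : R) @^-1` A.
have mX1 A : measurable A -> measurable (X1 A).
  by move=> mA; rewrite -[X in measurable X]setTI; exact: m1.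
have mX2 A : measurable A -> measurable (X2 A).
  by move=> mA; rewrite -[X in measurable X]setTI; exact: m2.
have mX3 A : measurable A -> measurable (X3 A).
  by move=> mA; rewrite -[X in measurable X]setTI; exact: m3.
have Q1 : X1 `]a.1.1, b.1.1[%classic `&` Q = Q by apply: setIidr => x [[]].
have Q2 : X2 `]a.1.2, b.1.2[%classic `&` Q = Q by apply: setIidr => x [[]].
have Q3 : X3 `]a.2, b.2[%classic `&` Q = Q by apply: setIidr => x [].
pose G := @RGenOpens.G R.
have gen : @measurable _ (measurableTypeR R) = <<s G >>.
  exact: RGenOpens.measurableE.
have Goo s t : G `]s, t[%classic by exists s, t.
have mG A : G A -> measurable A by move=> [s [t ->]].
have GI := @open_itvI_closed R.
have h0 A B C : G A -> G B -> G C ->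
    (\int[mu]_(x in X1 A `&` (X2 B `&` (X3 C `&` Q))) f x = 0)%E.
  move=> [s1 [t1 ->]] [s2 [t2 ->]] [s3 [t3 ->]].
  have := f0 (s1, s2, s3) (t1, t2, t3); congr (integral mu _ _ = _).
  by rewrite !setIA.
have h1 A B C : measurable A -> G B -> G C ->
    (\int[mu]_(x in X1 A `&` (X2 B `&` (X3 C `&` Q))) f x = 0)%E.
  move=> mA GB GC; have mS : measurable (X2 B `&` (X3 C `&` Q)).
    exact: measurableI (mX2 _ (mG _ GB)) (measurableI _ _ (mX3 _ (mG _ GC)) mQ).
  apply: (dynkin_integral0 m1 mS fi gen GI) => // [|A' GA']; last exact: h0.
  by have := h0 _ _ _ (Goo a.1.1 b.1.1) GB GC;
    rewrite setICA (setICA (X1 _)) Q1.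
have h2 A B C : measurable A -> measurable B -> G C ->
    (\int[mu]_(x in X2 B `&` (X1 A `&` (X3 C `&` Q))) f x = 0)%E.
  move=> mA mB GC; have mS : measurable (X1 A `&` (X3 C `&` Q)).
    exact: measurableI (mX1 _ mA) (measurableI _ _ (mX3 _ (mG _ GC)) mQ).
  apply: (dynkin_integral0 m2 mS fi gen GI) => // [|B' GB'].
    by have := h1 _ _ _ mA (Goo a.1.2 b.1.2) GC; rewrite (setICA (X2 _)) Q2.
  by have := h1 _ _ _ mA GB' GC; rewrite setICA.
have h3 A B C : measurable A -> measurable B -> measurable C ->
    (\int[mu]_(x in X3 C `&` (X2 B `&` (X1 A `&` Q))) f x = 0)%E.
  move=> mA mB mC; have mS : measurable (X2 B `&` (X1 A `&` Q)).
    exact: measurableI (mX2 _ mB) (measurableI _ _ (mX1 _ mA) mQ).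
  apply: (dynkin_integral0 m3 mS fi gen GI) => // [|C' GC'].
    by have := h2 _ _ _ mA mB (Goo a.2 b.2); rewrite Q3.
  have := h2 _ _ _ mA mB GC'.
  by rewrite (setICA (X1 A)) (setICA (X2 B)).
have rectI d d' (T : measurableType d) (T' : measurableType d') :
    setI_closed [set A `*` B | A in @measurable _ T & B in @measurable _ T'].
  move=> _ _ [A mA [B mB <-]] [A' mA' [B' mB' <-]].
  exists (A `&` A'); first exact: measurableI.
  by exists (B `&` B'); [exact: measurableI|rewrite setXI].
have h4 D C : measurable D -> measurable C ->
    (\int[mu]_(x in fst @^-1` D `&` (X3 C `&` Q)) f x = 0)%E.
  move=> mD mC; have mS : measurable (X3 C `&` Q).
    by apply: measurableI => //; exact: mX3.
  apply: (dynkin_integral0 measurable_fst mS fi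
    (@measurable_prod_measurableType _ _ _ _) (@rectI _ _ _ _)) => //.
    have := h3 _ _ _ measurableT measurableT mC.
    by rewrite /X1 /X2 !preimage_setT !setTI.
  move=> _ [A mA [B mB <-]]; have := h3 _ _ _ mA mB mC.
  rewrite setICA (setICA (X3 C)) setIA (setIC (X2 _)); exact.
move=> A mA.
apply: (dynkin_integral0 (@measurable_id _ _ _) mQ fi
  (@measurable_prod_measurableType _ _ _ _) (@rectI _ _ _ _)) => //.
  have := h4 _ _ measurableT measurableT.
  by rewrite /X3 !preimage_setT !setTI.
move=> _ [D mD [C mC <-]]; have := h4 _ _ mD mC.
by rewrite setIA.
Qed.

(** Countably many boxes, those with rational vertices, exhaust the ball; this is
    what reduces an almost everywhere statement on the ball to boxes. *)
Lemma oball_obox (r : R) (x : V) : oball r x ->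
  exists q : (rat * rat * rat) * (rat * rat * rat),
    let a : V := (ratr q.1.1.1, ratr q.1.1.2, ratr q.1.2) in
    let b : V := (ratr q.2.1.1, ratr q.2.1.2, ratr q.2.2) in
    obox a b x /\ cbox a b `<=` oball r.
Proof.
move=> xr.
have ce : continuous (@enorm R).
  have c1 : continuous (fun x : V => x.1.1).
    move=> y; apply: (@continuous_comp _ _ _ fst fst); exact: cvg_fst.
  have c2 : continuous (fun x : V => x.1.2).
    move=> y; apply: (@continuous_comp _ _ _ fst snd);
      [exact: cvg_fst|exact: cvg_snd].
  have c3 : continuous (fun x : V => x.2) by move=> y; exact: cvg_snd.
  move=> y; apply: continuous_comp; last exact: sqrt_continuous.
  rewrite /prop_for /continuous_at.
  by apply: cvgD; [apply: cvgD|]; apply: cvgM;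
    (exact: c1 || exact: c2 || exact: c3).
have ob : open (oball r) by apply: open_comp (@open_lt _ r) => y _; exact: ce.
have [e /= e0 eU] : exists2 e : R, 0 < e & ball x e `<=` oball r.
  by have /nbhs_ballP[e] := open_nbhs_nbhs (conj ob xr); exists e.
have approx (y : R) : exists pq : rat * rat,
    [/\ y - e < ratr pq.1, ratr pq.1 < y, y < ratr pq.2 & ratr pq.2 < y + e].
  have [p] : exists p : rat, ratr p \in `]y - e, y[.
    by have [|p] := @rat_in_itvoo R (y - e) y; [lra|exists p].
  have [q] : exists q : rat, ratr q \in `]y, y + e[.
    by have [|q] := @rat_in_itvoo R y (y + e); [lra|exists q].
  rewrite !in_itv/= => /andP[q1 q2] /andP[p1 p2].
  by exists (p, q).
have [[p1 q1] /= [a1 b1 c1 d1]] := approx x.1.1.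
have [[p2 q2] /= [a2 b2 c2 d2]] := approx x.1.2.
have [[p3 q3] /= [a3 b3 c3 d3]] := approx x.2.
exists ((p1, p2, p3), (q1, q2, q3)); split.
  by apply/oboxE; rewrite /= b1 c1 b2 c2 b3 c3.
move=> y [[]]; rewrite /= !in_itv/=.
move=> /andP[g1 k1] /andP[g2 k2] /andP[g3 k3]; apply: eU.
by split; [split|]; rewrite /ball/= ltr_norml; lra.
Qed.

End BoxesInBall.

(** * The du Bois-Reymond lemma *)

Section DuBoisReymond.
Context (R : realType) (r : R).
Local Notation mu := (ball_measure r).
Local Notation V := (R * R * R)%type.

(** Dominated convergence for the bumps of parameter c = 1/(n + 1), which tend to
    the indicator of the box and are bounded by 1. *)
Lemma test_integral0_obox (g : R3 R -> R) (a b : V) :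
  mu.-integrable [set: R3 R] (EFin \o g) ->
  (forall phi, is_test_function r phi -> \int[mu]_x (g x * phi x) = 0) ->
  cbox a b `<=` oball r -> (\int[mu]_(x in obox a b) (g x)%:E = 0)%E.
Proof.
move=> gi g0 abr.
have mg : measurable_fun [set: R3 R] g by apply/measurable_EFinP/measurable_int/gi.
have c0 n : 0 < n.+1%:R^-1 :> R by [].
pose phi n : R3 R -> R := box_bump n.+1%:R^-1 a b.
have mphi n : measurable_fun [set: R3 R] (phi n).
  apply: continuous_measurable3; apply: (@is_Ck_continuous _ 0).
  exact: is_Ck_box_bump.
have mgphi n : measurable_fun [set: R3 R] (fun x => (g x * phi n x)%:E).
  by apply/measurable_EFinP; exact: measurable_funM.
have bnd n x : (`|(g x * phi n x)%:E| <= `|(g x)%:E|)%E.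
  rewrite lee_fin normrM ler_piMr// ger0_norm ?box_bump_ge0//.
  by rewrite box_bump_le1.
have int0 n : (\int[mu]_x (g x * phi n x)%:E = 0)%E.
  have : mu.-integrable [set: R3 R] (fun x => (g x * phi n x)%:E).
    by apply: le_integrable gi => // x _; exact: bnd.
  move=> /(integrable_fin_num measurableT)/fineK <-.
  by congr EFin; apply: g0; exact: box_bump_test_function.
have mo := measurable_obox a b.
have [|||||] := @dominated_convergence _ _ _ mu _ measurableT
  (fun n x => (g x * phi n x)%:E) (fun x => (g x * \1_(obox a b) x)%:E)
  (fun x => `|(g x)%:E|%E).
- exact: mgphi.
- by apply/measurable_EFinP; apply: measurable_funM => //; exact: measurable_indic.
- apply: aeW => x _; apply: cvg_EFin; first exact: nearW.
  by apply: cvgM; [exact: cvg_cst|exact: cvg_box_bump].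
- exact: integrable_abse.
- by apply: aeW => x n _; exact: bnd.
move=> _ _ lim.
have -> : (\int[mu]_(x in obox a b) (g x)%:E =
    \int[mu]_x (g x * \1_(obox a b) x)%:E)%E.
  rewrite integral_mkcond; apply: eq_integral => x _.
  by rewrite patchE indicE; case: ifPn => _; rewrite ?mulr1 ?mulr0.
rewrite -(cvg_lim _ lim)//; apply: lim_near_cst => //.
by apply: nearW => n; exact: int0.
Qed.

(** The intersection of two boxes is a box, so the integrals of g vanish over all
    boxes inside a given box, hence over all its measurable subsets; countably
    many boxes cover the ball. *)
Lemma test_integral0_ae (g : R3 R -> R) :
  mu.-integrable [set: R3 R] (EFin \o g) ->
  (forall phi, is_test_function r phi -> \int[mu]_x (g x * phi x) = 0) ->
  {ae mu, forall x, g x = 0}.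
Proof.
move=> gi g0.
have onbox (a b : V) : cbox a b `<=` oball r ->
    {ae mu, forall x : R3 R, obox a b x -> g x = 0}.
  move=> abr; have mo := measurable_obox a b.
  have boxes a' b' : (\int[mu]_(x in obox a' b' `&` obox a b) (g x)%:E = 0)%E.
    pose lo : V := (Num.max a'.1.1 a.1.1, Num.max a'.1.2 a.1.2, Num.max a'.2 a.2).
    pose hi : V := (Num.min b'.1.1 b.1.1, Num.min b'.1.2 b.1.2, Num.min b'.2 b.2).
    have -> : obox a' b' `&` obox a b = obox lo hi.
      apply/seteqP; split => x.
        move=> [/oboxE/and3P[/andP[? ?] /andP[? ?] /andP[? ?]]].
        move=> /oboxE/and3P[/andP[? ?] /andP[? ?] /andP[? ?]].
        by apply/oboxE; rewrite /= !gt_max !lt_min; apply/and3P; split;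
          apply/andP; split; apply/andP; split.
      move=> /oboxE; rewrite /= !gt_max !lt_min => /and3P[].
      move=> /andP[/andP[? ?] /andP[? ?]] /andP[/andP[? ?] /andP[? ?]].
      move=> /andP[/andP[? ?] /andP[? ?]].
      by split; apply/oboxE/and3P; split; apply/andP; split.
    apply: test_integral0_obox => //; apply: subset_trans abr.
    move=> x [[]]; rewrite /= !in_itv/= !ge_max !le_min.
    move=> /andP[/andP[? ?] /andP[? ?]] /andP[/andP[? ?] /andP[? ?]].
    move=> /andP[/andP[? ?] /andP[? ?]].
    by split; [split|]; rewrite /= in_itv/=; apply/andP; split.
  have all0 := integral0_obox_measurable gi boxes.
  have : ae_eq mu (obox a b) (EFin \o g) (cst 0%E).
    apply: integral_ae_eq => //; first exact: integrableS gi.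
    move=> E Eab mE; rewrite integral0 -(setIidl Eab); exact: all0.
  by apply: filterS => x /= H abx; have [] := H abx.
pose P (n : nat) (x : R3 R) := if unpickle n is Some q then
    let a : V := (ratr q.1.1.1, ratr q.1.1.2, ratr q.1.2) in
    let b : V := (ratr q.2.1.1, ratr q.2.1.2, ratr q.2.2) in
    cbox a b `<=` oball r -> obox a b x -> g x = 0
  else True.
have /ae_foralln : forall n, {ae mu, forall x, P n x}.
  move=> n; rewrite /P; case: (unpickle n) => [q|]; last exact: aeW.
  case: (pselect (cbox (ratr q.1.1.1, ratr q.1.1.2, ratr q.1.2)
    (ratr q.2.1.1, ratr q.2.1.2, ratr q.2.2) `<=` oball r)) => [sub|nsub].
    by have := onbox _ _ sub; apply: filterS => x /= H _.
  by apply: aeW => x /nsub.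
pose U : set (R3 R) := oball r.
have inball : {ae mu, forall x, U x}.
  exists (~` (oball r) : set (R3 R)); split=> //.
  - by apply: measurableC; exact: measurable_oball.
  - by rewrite /ball_measure/= /mrestr setICl measure0.
apply: filterS2 inball => x xr /= allP.
have [q [xq qr]] := oball_obox xr.
by have := allP (pickle q); rewrite /P pickleK; apply.
Qed.

End DuBoisReymond.

(** * Square-integrable functions *)

Section SquareIntegrable.
Context d (T : measurableType d) (R : realType).
Variable mu : {measure set T -> \bar R}.
Local Notation L2 := (Lfun mu 2%:E).

(** Both sides are 0 when the integral is infinite, because [fine] maps +oo
    to 0. *)
Lemma Lnorm2_sqr (f : T -> R) :
  fine ('N[mu]_(2%:E)[EFin \o f])%E ^+ 2 = \int[mu]_x (f x * f x).
Proof.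
rewrite /Rintegral.
have -> : (\int[mu]_x (f x * f x)%:E = 'N[mu]_(2%:E)[EFin \o f] `^ 2)%E.
  rewrite powR_Lnorm//; apply: eq_integral => x _ /=.
  by rewrite powR_mulrn// real_normK ?num_real.
have := Lnorm_ge0 mu 2%:E (EFin \o f).
case: ('N[mu]_(2%:E)[EFin \o f])%E => [s|_|] //=.
  by rewrite lee_fin => s0; rewrite powR_mulrn.
by rewrite expr0n pnatr_eq0.
Qed.

Lemma Lfun2P (f : T -> R) : f \in L2 <->
  measurable_fun [set: T] f /\ (\int[mu]_x (f x ^+ 2)%:E < +oo)%E.
Proof.
have E : (\int[mu]_x (f x ^+ 2)%:E = 'N[mu]_(2%:E)[EFin \o f] `^ 2)%E.
  rewrite powR_Lnorm//; apply: eq_integral => x _ /=.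
  by rewrite powR_mulrn// real_normK ?num_real.
rewrite E; split.
  rewrite inE => /andP[/[!inE]/= mf ff]; split=> //; exact: poweR_lty.
move=> [mf ff]; rewrite inE; apply/andP; split; rewrite inE//=.
by apply: lty_poweRy ff.
Qed.

Lemma Lfun2_measurable (f : T -> R) : f \in L2 -> measurable_fun [set: T] f.
Proof. by move=> /Lfun2P[]. Qed.

Lemma Lfun2D (f g : T -> R) : f \in L2 -> g \in L2 -> (f \+ g) \in L2.
Proof.
have l12 : (1 <= 2%:E :> \bar R)%E by rewrite lee_fin ler1n.
by move=> Lf Lg; have [_] := Lfun_addr_closed mu l12; exact.
Qed.

Lemma Lfun2Z (a : R) (f : T -> R) : f \in L2 -> (fun x => a * f x) \in L2.
Proof.
move=> Lf; have -> : (fun x => a * f x) = a \o* f.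
  by apply/funext => x /=; rewrite mulrC.
by apply: Lfun_scale => //; rewrite ler1n.
Qed.

Lemma Lfun2B (f g : T -> R) : f \in L2 -> g \in L2 -> (f \- g) \in L2.
Proof.
move=> Lf Lg; rewrite (_ : f \- g = f \+ (fun x => -1 * g x)).
  by apply: Lfun2D => //; exact: Lfun2Z.
by apply/funext => x /=; rewrite mulN1r.
Qed.

Definition inner (f g : T -> R) : R := \int[mu]_x (f x * g x).

Lemma mul_integrable (f g : T -> R) : f \in L2 -> g \in L2 ->
  mu.-integrable [set: T] (fun x => (f x * g x)%:E).
Proof. by move=> Lf Lg; apply/Lfun1_integrable; exact: Lfun2_mul_Lfun1. Qed.

Lemma innerC f g : inner f g = inner g f.
Proof. by apply: eq_Rintegral => x _; rewrite mulrC. Qed.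

Lemma inner_ge0 f : 0 <= inner f f.
Proof. by apply: Rintegral_ge0 => x _; rewrite -expr2 sqr_ge0. Qed.

Lemma innerDZl (a : R) f g h : f \in L2 -> g \in L2 -> h \in L2 ->
  inner (fun x => a * f x + g x) h = a * inner f h + inner g h.
Proof.
move=> Lf Lg Lh; rewrite /inner -RintegralZl//; last exact: mul_integrable.
rewrite -RintegralD//; last 2 first.
- by have := mul_integrable (Lfun2Z a Lf) Lh;
    apply: eq_integrable => // x _ /=; rewrite mulrA.
- exact: mul_integrable.
by apply: eq_Rintegral => x _; rewrite mulrDl mulrA.
Qed.

Lemma innerBl f g h : f \in L2 -> g \in L2 -> h \in L2 ->
  inner (f \- g) h = inner f h - inner g h.
Proof.
move=> Lf Lg Lh; rewrite addrC -mulN1r -innerDZl//.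
by apply: eq_Rintegral => x _ /=; rewrite mulN1r addrC.
Qed.

Lemma inner_cauchy_schwarz f g : f \in L2 -> g \in L2 ->
  inner f g ^+ 2 <= inner f f * inner g g.
Proof.
move=> Lf Lg; apply: discriminant_le0; first exact: inner_ge0.
move=> t; pose h x := t * f x + g x.
have Lh : h \in L2 by apply: Lfun2D => //; exact: Lfun2Z.
have := inner_ge0 h; rewrite {1}/h innerDZl//.
rewrite (innerC f h) (innerC g h) /h !innerDZl// (innerC g f).
lra.
Qed.

Lemma eq_ae_inner f f' g g' : f \in L2 -> g \in L2 -> f' \in L2 -> g' \in L2 ->
  {ae mu, forall x, f x = f' x} -> {ae mu, forall x, g x = g' x} ->
  inner f g = inner f' g'.
Proof.
move=> Lf Lg Lf' Lg' ff' gg'; congr fine; apply: ae_eq_integral => //.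
- exact/measurable_int/(mul_integrable Lf Lg).
- exact/measurable_int/(mul_integrable Lf' Lg').
by apply: filterS2 ff' gg' => x -> -> _.
Qed.

Lemma inner_eq0 f : f \in L2 -> inner f f = 0 -> {ae mu, forall x, f x = 0}.
Proof.
move=> Lf; have fi := mul_integrable Lf Lf.
have /fineK E := integrable_fin_num measurableT fi.
rewrite /inner /Rintegral => f0; move: E; rewrite {}f0 => /esym E.
have : (\int[mu]_x `|(f x * f x)%:E| = 0)%E.
  by rewrite -[RHS]E; apply: eq_integral => x _; rewrite gee0_abs// lee_fin
    -expr2 sqr_ge0.
move/(ae_eq_integral_abs mu measurableT (measurable_int mu fi)).
apply: filterS => x /= /(_ I) [] /eqP.
by rewrite mulf_eq0 orbb => /eqP.
Qed.

Section FiniteMeasure.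
Hypothesis mu_fin : mu [set: T] \is a fin_num.

Lemma Lfun2_cst (c : R) : cst c \in L2.
Proof.
apply/Lfun2P; split; first exact: measurable_cst.
rewrite (integral_cst mu measurableT (c ^+ 2)%:E).
by rewrite ltey_eq fin_numM.
Qed.

Lemma Lfun2_normr f : f \in L2 -> (fun x => `|f x|) \in L2.
Proof.
move=> /Lfun2P[mf ff]; apply/Lfun2P; split; first exact: measurableT_comp.
apply: le_lt_trans ff; rewrite le_eqVlt; apply/orP; left; apply/eqP.
by apply: eq_integral => x _; rewrite real_normK ?num_real.
Qed.

Lemma Rintegral_normr_sqr_le f : f \in L2 ->
  (\int[mu]_x `|f x|) ^+ 2 <= fine (mu [set: T]) * inner f f.
Proof.
move=> Lf; have := inner_cauchy_schwarz (Lfun2_normr Lf) (Lfun2_cst 1).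
rewrite mulrC; congr (_ ^+ 2 <= _ * _).
- by apply: eq_Rintegral => x _; rewrite mulr1.
- transitivity (\int[mu]_(_ in [set: T]) (1 * 1 : R)); first by [].
  by rewrite Rintegral_cst// !mul1r.
- by apply: eq_Rintegral => x _; rewrite -!expr2 real_normK ?num_real.
Qed.

Lemma limn_einf_le (u : (\bar R)^nat) (c : \bar R) :
  (forall n, (u n <= c)%E) -> (limn_einf u <= c)%E.
Proof.
move=> uc; rewrite limn_einf_lim; apply: lime_le; first exact: is_cvg_einfs.
apply: nearW => n; apply: le_trans (uc n); apply: ereal_inf_lbound.
by exists n => /=.
Qed.

(** On a finite measure space the increments have L^1 norms at most a constant
    times 2^-n; so their sum is integrable, hence finite almost everywhere, and
    the telescoping series converges absolutely there. *)
Lemma fast_cauchy_ae_cvg (u : nat -> T -> R) : (forall n, u n \in L2) ->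
  (forall n m, (n <= m)%N -> inner (u m \- u n) (u m \- u n) <= 4^-1 ^+ n) ->
  {ae mu, forall x, cvgn (u ^~ x)}.
Proof.
move=> Lu uc; pose dlt n x : R := `|u n.+1 x - u n x|.
have Ld n : (u n.+1 \- u n) \in L2 by apply: Lfun2B.
have mdlt n : measurable_fun [set: T] (fun x => (dlt n x)%:E).
  by apply/measurable_EFinP; apply: measurableT_comp => //;
    exact: (Lfun2_measurable (Ld n)).
have dlt0 n x : (0 <= (dlt n x)%:E)%E by rewrite lee_fin normr_ge0.
pose M := fine (mu [set: T]).
have M0 : 0 <= M by exact: fine_ge0.
have dle n : (\int[mu]_x (dlt n x)%:E <= (Num.sqrt M * 2^-1 ^+ n)%:E)%E.
  have di : mu.-integrable [set: T] (fun x => (dlt n x)%:E).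
    have := mul_integrable (Lfun2_normr (Ld n)) (Lfun2_cst 1).
    by apply: eq_integrable => // x _ /=; rewrite mulr1.
  have /fineK <- := integrable_fin_num measurableT di.
  rewrite lee_fin; apply: le_of_sqr.
    by rewrite mulr_ge0 ?sqrtr_ge0 ?exprn_ge0.
  apply: (le_trans (Rintegral_normr_sqr_le (Ld n))).
  rewrite exprMn sqr_sqrtr// ler_wpM2l//; apply: le_trans (uc _ _ (leqnSn n)) _.
  by rewrite -exprM mulnC exprM expr2 -invfM -natrM.
have : (\int[mu]_x (\sum_(n <oo) (dlt n x)%:E) < +oo)%E.
  rewrite integral_nneseries//.
  apply: (@le_lt_trans _ _ (\sum_(n <oo) (Num.sqrt M * 2^-1 ^+ n)%:E)%E).
    apply: lee_nneseries => n _; last exact: dle.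
    by move=> _; apply: integral_ge0 => x _; exact: dlt0.
  have gc : series (geometric (Num.sqrt M) 2^-1) @ \oo -->
      Num.sqrt M * (1 - 2^-1)^-1.
    by apply: cvg_geometric_series; rewrite ger0_norm// invf_lt1// ltr1n.
  have gE : (fun n => (\sum_(0 <= i < n) (Num.sqrt M * 2^-1 ^+ i)%:E)%E) =
      EFin \o series (geometric (Num.sqrt M) 2^-1).
    by apply/funext => n /=; rewrite sumEFin.
  have gc' : ((EFin \o series (geometric (Num.sqrt M) 2^-1)) n @[n --> \oo] -->
      (Num.sqrt M * (1 - 2^-1)^-1)%:E)%E.
    by apply: cvg_EFin; [exact: nearW|exact: gc].
  by rewrite gE (cvg_lim _ gc')// ltry.
move=> fin_sum.
have si : mu.-integrable [set: T] (fun x => \sum_(n <oo) (dlt n x)%:E)%E.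
  apply/integrableP; split.
    by apply: ge0_emeasurable_sum.
  apply: le_lt_trans fin_sum; rewrite le_eqVlt; apply/orP; left; apply/eqP.
  by apply: eq_integral => x _; rewrite gee0_abs// nneseries_ge0.
have := integrable_ae measurableT si.
apply: filterS => x /(_ I) sfin.
have cs : cvgn (series (fun n => u n.+1 x - u n x)).
  apply: normed_cvg.
  have : cvgn (fun n => (\sum_(0 <= i < n) (dlt i x)%:E)%E).
    by apply: is_cvg_nneseries.
  move=> /cvg_ex[l cl]; have lE := cvg_lim (@ereal_hausdorff R) cl.
  move: sfin; rewrite lE => lfin.
  move: cl; rewrite -(fineK lfin) => /fine_cvgP[_ cl].
  apply/cvg_ex; exists (fine l); apply: cvg_trans cl.
  by apply: near_eq_cvg; apply: nearW => n /=; rewrite sumEFin.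
have E n : u n x = u 0%N x + series (fun n => u n.+1 x - u n x) n.
  by rewrite /series/= telescope_sumr// addrC subrK.
rewrite (funext E).
by apply: is_cvgD => //; exact: is_cvg_cst.
Qed.

(** The limit is taken pointwise almost everywhere; Fatou's lemma applied to
    (u n - u (m + n))^2 as m tends to infinity carries the Cauchy bound over to
    u n - v. Defining v as an upper limit makes it measurable everywhere. *)
Lemma L2_complete (u : nat -> T -> R) : (forall n, u n \in L2) ->
  (forall n m, (n <= m)%N -> inner (u m \- u n) (u m \- u n) <= 4^-1 ^+ n) ->
  exists2 v, v \in L2 & forall n, inner (u n \- v) (u n \- v) <= 4^-1 ^+ n.
Proof.
move=> Lu uc; pose v x : R := fine (limn_esup (fun n => (u n x)%:E)).
have mv : measurable_fun [set: T] v.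
  apply: measurableT_comp => //; apply: measurable_fun_limn_esup => n.
  exact/measurable_EFinP/Lfun2_measurable.
have uv : {ae mu, forall x, u n x @[n --> \oo] --> v x}.
  have := fast_cauchy_ae_cvg Lu uc; apply: filterS => x /cvg_ex[l ul].
  have ul' : ((u n x)%:E @[n --> \oo] --> l%:E)%E.
    by apply: cvg_EFin; [exact: nearW|exact: ul].
  by rewrite /v (cvg_limn_einf_sup ul').2.
have key n : (\int[mu]_x ((u n x - v x) ^+ 2)%:E <= (4^-1 ^+ n)%:E)%E.
  pose F m x := ((u n x - u (m + n)%N x) ^+ 2)%:E.
  have mF m : measurable_fun [set: T] (F m).
    apply/measurable_EFinP/measurable_funX.
    exact: (Lfun2_measurable (Lfun2B (Lu _) (Lu _))).
  have -> : (\int[mu]_x ((u n x - v x) ^+ 2)%:E =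
      \int[mu]_x limn_einf (F ^~ x))%E.
    apply: ae_eq_integral => //.
    - apply/measurable_EFinP/measurable_funX/measurable_funB => //.
      exact: Lfun2_measurable.
    - apply: measurableT_comp => //.
      apply: measurable_fun_limn_esup => m; exact: measurableT_comp (mF m).
    move: uv; apply: filterS => x ux _.
    suff : (F m x @[m --> \oo] --> ((u n x - v x) ^+ 2)%:E)%E.
      by move=> /cvg_limn_einf_sup[-> _].
    apply: cvg_EFin; first exact: nearW.
    have ux' : u (m + n)%N x @[m --> \oo] --> v x.
      move: ux; rewrite -(cvg_shiftn n); apply: cvg_trans.
      by apply: near_eq_cvg; apply: nearW => m /=; rewrite addnC.
    have sub : u n x - u (m + n)%N x @[m --> \oo] --> u n x - v x.
      by apply: cvgB ux'; exact: cvg_cst.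
    exact: (cvgM sub sub).
  apply: (le_trans (fatou mu measurableT mF _)).
    by move=> m x _; rewrite lee_fin sqr_ge0.
  apply: limn_einf_le => m.
  have Lnm : (u (m + n)%N \- u n) \in L2 by apply: Lfun2B.
  have := uc n (m + n)%N (leq_addl _ _).
  rewrite -lee_fin /inner /Rintegral fineK; last first.
    exact: (integrable_fin_num measurableT (mul_integrable Lnm Lnm)).
  apply: le_trans; rewrite le_eqVlt; apply/orP; left; apply/eqP.
  by apply: eq_integral => x _; rewrite /F /= -expr2 -sqrrN opprB.
have Luv n : (u n \- v) \in L2.
  apply/Lfun2P; split; last exact: le_lt_trans (key n) (ltry _).
  by apply: measurable_funB => //; exact: Lfun2_measurable.
have Lv : v \in L2.
  rewrite (_ : v = u 0%N \- (u 0%N \- v)); first exact: Lfun2B.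
  by apply/funext => x /=; rewrite opprB addrC subrK.
exists v => // n; rewrite -lee_fin /inner /Rintegral fineK; last first.
  exact: (integrable_fin_num measurableT (mul_integrable (Luv n) (Luv n))).
exact: key.
Qed.

End FiniteMeasure.
End SquareIntegrable.

(** * The inner product of H^1 *)

Section SobolevSpace.
Context (R : realType) (r : R).
Local Notation mu := (ball_measure r).
Local Notation L2 := (Lfun mu 2%:E).
Local Notation ip := (inner mu).

Lemma test_Lfun2 (phi : R * R * R -> R) : is_test_function r phi ->
  (phi : R3 R -> R) \in L2.
Proof. by move=> [/(_ 0%N)[cphi _] _ _]; exact: continuous_Lfun2. Qed.

Lemma partial_test_Lfun2 (i : 'I_3) (phi : R * R * R -> R) :
  is_test_function r phi -> (partial i phi : R3 R -> R) \in L2.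
Proof.
by move=> [/(_ 1%N)[_ /(_ i)[_ [cphi _]]] _ _]; exact: continuous_Lfun2.
Qed.

Lemma weak_partialP (i : 'I_3) (f : R3 R -> R^o) : f \in H1 r ->
  weak_partial r i f \in L2 /\ is_weak_partial r i f (weak_partial r i f).
Proof.
move=> /asboolP[Lf /(_ i)[g Lg fg]].
have ex : exists g, (fun g : R3 R -> R => g \in L2 /\ is_weak_partial r i f g) g.
  by exists g.
exact: (xgetPex (cst 0) ex).
Qed.

(** The integration by parts identities show that g - g' integrates to zero against
    all test functions. *)
Lemma weak_partial_unique (i : 'I_3) (f f' g g' : R3 R -> R) :
  f \in L2 -> f' \in L2 -> g \in L2 -> g' \in L2 ->
  {ae mu, forall x, f x = f' x} ->
  is_weak_partial r i f g -> is_weak_partial r i f' g' ->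
  {ae mu, forall x, g x = g' x}.
Proof.
move=> Lf Lf' Lg Lg' ff' fg fg'.
have Lgg' : (g \- g') \in L2 by exact: Lfun2B.
have : {ae mu, forall x, (g \- g') x = 0}.
  apply: test_integral0_ae => [|phi tphi].
    by apply/Lfun1_integrable/Lfun_subset12 => //; exact: ball_measure_fin.
  have Lphi := test_Lfun2 tphi; have Ldphi := partial_test_Lfun2 i tphi.
  rewrite -[LHS]/(ip (g \- g') phi) innerBl//.
  have := fg phi tphi; have := fg' phi tphi.
  rewrite -![\int[mu]_x (_ * partial i phi x)]/(ip _ (partial i phi)).
  rewrite -![\int[mu]_x (_ * phi x)]/(ip _ phi).
  have -> : ip f (partial i phi) = ip f' (partial i phi).
    by apply: eq_ae_inner => //; exact: aeW.
  by move=> -> /eqP; rewrite eqr_opp => /eqP ->; rewrite subrr.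
by apply: filterS => x /= /eqP; rewrite subr_eq0 => /eqP.
Qed.

(** The defect s of the identity for the limits is bounded, by Cauchy-Schwarz, by
    the L^2 distances to the approximating functions, which satisfy the
    identity exactly. *)
Lemma is_weak_partial_closed (i : 'I_3) (f g : R3 R -> R)
    (fn gn : nat -> R3 R -> R) :
  f \in L2 -> g \in L2 -> (forall n, fn n \in L2) -> (forall n, gn n \in L2) ->
  (forall n, is_weak_partial r i (fn n) (gn n)) ->
  (forall n, ip (fn n \- f) (fn n \- f) <= 4^-1 ^+ n) ->
  (forall n, ip (gn n \- g) (gn n \- g) <= 4^-1 ^+ n) ->
  is_weak_partial r i f g.
Proof.
move=> Lf Lg Lfn Lgn wn fnf gng phi tphi.
have Lphi := test_Lfun2 tphi; have Ldphi := partial_test_Lfun2 i tphi.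
rewrite -[LHS]/(ip f (partial i phi)) -[\int[mu]_x _]/(ip g phi).
pose s := ip f (partial i phi) + ip g phi.
pose K := 2 * (ip (partial i phi) (partial i phi) + ip phi phi).
have sK n : s ^+ 2 <= 4^-1 ^+ n * K.
  have := wn n phi tphi; rewrite -[LHS]/(ip (fn n) (partial i phi)).
  rewrite -[\int[mu]_x _]/(ip (gn n) phi) => E.
  have h1 := inner_cauchy_schwarz (Lfun2B (Lfn n) Lf) Ldphi.
  have h2 := inner_cauchy_schwarz (Lfun2B (Lgn n) Lg) Lphi.
  have h3 := ler_wpM2r (inner_ge0 mu (partial i phi)) (fnf n).
  have h4 := ler_wpM2r (inner_ge0 mu phi) (gng n).
  move: (le_trans h1 h3) (le_trans h2 h4); rewrite !innerBl// E /s /K.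
  set a := ip f _; set b := ip g _; set c := ip (gn n) _.
  set p := ip _ _; set q := ip _ _; set e := _ ^+ n => k1 k2.
  have := sqr_ge0 ((- c - a) - (c - b)); lra.
suff s0 : s = 0 by apply/eqP; rewrite -subr_eq0 opprK; apply/eqP.
have : s ^+ 2 <= 0.
  have lim : (fun n => 4^-1 ^+ n * K) @ \oo --> (0 * K).
    apply: cvgM; last exact: cvg_cst.
    by apply: cvg_expr; rewrite ger0_norm// invf_lt1// ltr1n.
  rewrite -[leRHS](mul0r K) -(cvg_lim _ lim)//.
  by apply: limr_ge; [apply/cvg_ex; exists (0 * K)|apply: nearW].
by rewrite real_exprn_even_le0 ?num_real//= => /eqP.
Qed.

Lemma H1L1fun_Lfun2 (f : H1L1fun r) : (f : R3 R -> R) \in L2.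
Proof. by case: f => f /= /andP[/asboolP[]]. Qed.

Lemma H1L1fun_H1 (f : H1L1fun r) : (f : R3 R -> R^o) \in H1 r.
Proof. by case: f => f /= /andP[]. Qed.

Lemma repr_pi_ae (f : H1L1fun r) :
  {ae mu, forall x, (repr (\pi_(H1L1 r) f)%qT : H1L1fun r) x = f x}.
Proof.
have : (repr (\pi_(H1L1 r) f)%qT - f : H1L1fun r) \in @ae_zero R r.
  by rewrite Quotient.idealrBE reprK.
move=> /asboolP; apply: filterS => x /eqP.
by rewrite -[X in X == 0]/(_ x - f x) subr_eq0 => /eqP.
Qed.

Lemma H1L1_linE (a : R) (u v : H1L1 r) :
  a *: u + v = (\pi_(H1L1 r) (a *: (repr u : H1L1fun r) + repr v))%qT.
Proof.
rewrite (@Quotient.pi_add _ (@ae_zero R r)) -[in RHS]/(_ + _).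
by rewrite -pi_scale !reprK.
Qed.

Lemma repr_linear_ae (a : R) (u v : H1L1 r) :
  {ae mu, forall x, (repr (a *: u + v) : H1L1fun r) x =
    a * (repr u : H1L1fun r) x + (repr v : H1L1fun r) x}.
Proof. rewrite H1L1_linE; exact: repr_pi_ae. Qed.

(** The first-order jet of a class: index 0 is the function, index i + 1 its i-th
    weak derivative. Treating the four components alike reduces the facts about
    H^1 to facts about L^2. *)
Definition jet (j : 'I_4) (u : H1L1 r) : R3 R -> R :=
  if unlift ord0 j is Some i then weak_partial r i (repr u : H1L1fun r)
  else (repr u : H1L1fun r).

Lemma jet_Lfun2 j u : jet j u \in L2.
Proof.
rewrite /jet; case: unliftP => [i _|_]; last exact: H1L1fun_Lfun2.
by have [] := weak_partialP i (H1L1fun_H1 (repr u)).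
Qed.

(** Uniqueness of weak derivatives: any representative and any weak derivatives of
    it compute the jet up to null sets, whatever choices [repr] and
    [weak_partial] make. *)
Lemma jet_pi_ae (f : H1L1fun r) (g : 'I_3 -> R3 R -> R) :
  (forall i, g i \in L2) -> (forall i, is_weak_partial r i f (g i)) ->
  forall j, {ae mu, forall x, jet j (\pi_(H1L1 r) f)%qT x =
    (if unlift ord0 j is Some i then g i else f) x}.
Proof.
move=> Lg wg j; rewrite /jet; case: unliftP => [i _|_]; last exact: repr_pi_ae.
have [Lw ww] := weak_partialP i (H1L1fun_H1 (repr (\pi_(H1L1 r) f)%qT)).
apply: (weak_partial_unique _ _ Lw (Lg i) (repr_pi_ae f) ww (wg i));
  exact: H1L1fun_Lfun2.
Qed.

Lemma jet_linear_ae j (a : R) (u v : H1L1 r) :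
  {ae mu, forall x, jet j (a *: u + v) x = a * jet j u x + jet j v x}.
Proof.
pose w i := weak_partial r i.
have Pu i := weak_partialP i (H1L1fun_H1 (repr u)).
have Pv i := weak_partialP i (H1L1fun_H1 (repr v)).
have := @jet_pi_ae (a *: (repr u : H1L1fun r) + repr v)
  (fun i => (fun x => a * w i (repr u : H1L1fun r) x + w i (repr v : H1L1fun r) x)).
rewrite -H1L1_linE => H.
have {H} := H _ _ j; rewrite /jet; case: (unlift ord0 j) => [i|] H; apply: H.
- by move=> k; apply: Lfun2D; [apply: Lfun2Z; exact: (Pu k).1|exact: (Pv k).1].
- move=> k; apply: (is_weak_partial_linear a _ (Pu k).1 _ (Pv k).1 (Pu k).2 (Pv k).2);
    exact: H1L1fun_Lfun2.
- by move=> k; apply: Lfun2D; [apply: Lfun2Z; exact: (Pu k).1|exact: (Pv k).1].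
- move=> k; apply: (is_weak_partial_linear a _ (Pu k).1 _ (Pv k).1 (Pu k).2 (Pv k).2);
    exact: H1L1fun_Lfun2.
Qed.

Lemma jet_sub_ae j (u v : H1L1 r) :
  {ae mu, forall x, jet j (u - v) x = jet j u x - jet j v x}.
Proof.
rewrite addrC -scaleN1r; have := jet_linear_ae j (-1) v u.
by apply: filterS => x ->; rewrite mulN1r addrC.
Qed.

Definition H1_inner (u v : H1L1 r) : R := \sum_(j < 4) ip (jet j u) (jet j v).

Definition L1_seminorm (u : H1L1 r) : R :=
  \int[mu]_x `|(repr u : H1L1fun r) x|.

Lemma H1_inner_sym u v : H1_inner u v = H1_inner v u.
Proof. by apply: eq_bigr => j _; rewrite innerC. Qed.

Lemma H1_inner_linear a u v w :
  H1_inner (a *: u + v) w = a * H1_inner u w + H1_inner v w.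
Proof.
rewrite /H1_inner mulr_sumr -big_split/=; apply: eq_bigr => j _.
have Lu := jet_Lfun2 j u; have Lv := jet_Lfun2 j v; have Lw := jet_Lfun2 j w.
rewrite -innerDZl//; apply: eq_ae_inner => //.
- exact: jet_Lfun2.
- by apply: Lfun2D => //; exact: Lfun2Z.
- exact: jet_linear_ae.
- exact: aeW.
Qed.

Lemma inner_jet_le j u : ip (jet j u) (jet j u) <= H1_inner u u.
Proof.
rewrite /H1_inner (bigD1 j)//= lerDl sumr_ge0// => i _; exact: inner_ge0.
Qed.

Lemma H1_inner_ge0 u : 0 <= H1_inner u u.
Proof. by apply: sumr_ge0 => j _; exact: inner_ge0. Qed.

Lemma jet0 u : jet ord0 u = (repr u : H1L1fun r).
Proof. by rewrite /jet unlift_none. Qed.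

Lemma H1_inner_eq0 u : H1_inner u u = 0 -> u = 0.
Proof.
move=> u0; have : ip (jet ord0 u) (jet ord0 u) = 0.
  by apply/eqP; rewrite eq_le inner_ge0 andbT -u0 inner_jet_le.
move=> /(inner_eq0 (jet_Lfun2 _ _)); rewrite jet0 => rep0.
rewrite -[u]reprK; apply/eqP.
have pi0 : (\pi_(H1L1 r) 0)%qT = 0.
  apply: (@addrI (H1L1 r) (\pi_(H1L1 r) 0)%qT); rewrite addr0.
  by have := @Quotient.pi_add _ (@ae_zero R r) 0 0; rewrite addr0.
rewrite -pi0.
by rewrite -Quotient.idealrBE subr0; apply/asboolP.
Qed.

Lemma eq_ae_Rintegral_normr (f g : R3 R -> R) : f \in L2 -> g \in L2 ->
  {ae mu, forall x, f x = g x} ->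
  \int[mu]_x `|f x| = \int[mu]_x `|g x|.
Proof.
move=> Lf Lg fg; congr fine; apply: ae_eq_integral => //.
- by apply/measurable_EFinP; apply: measurableT_comp => //; exact: Lfun2_measurable Lf.
- by apply/measurable_EFinP; apply: measurableT_comp => //; exact: Lfun2_measurable Lg.
by apply: filterS fg => x -> _.
Qed.

Lemma normr_integrable (f : R3 R -> R) : f \in L2 ->
  mu.-integrable [set: R3 R] (fun x => `|f x|%:E).
Proof.
move=> Lf; apply/Lfun1_integrable/Lfun_subset12; first exact: ball_measure_fin.
exact: Lfun2_normr.
Qed.

Lemma L1_seminorm_scale a u : L1_seminorm (a *: u) = `|a| * L1_seminorm u.
Proof.
have Lu := H1L1fun_Lfun2 (repr u).
rewrite /L1_seminorm -RintegralZl//; last exact: normr_integrable.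
rewrite (@eq_ae_Rintegral_normr _ (fun x => a * (repr u : H1L1fun r) x)).
- by apply: eq_Rintegral => x _; rewrite normrM.
- exact: H1L1fun_Lfun2.
- exact: Lfun2Z.
have := repr_linear_ae a u 0; rewrite addr0.
have : {ae mu, forall x, (repr (0 : H1L1 r) : H1L1fun r) x = 0}.
  have := repr_linear_ae (-1) 0 0; rewrite scaler0 addr0.
  by apply: filterS => x; rewrite mulN1r addNr.
by apply: filterS2 => x -> ->; rewrite addr0.
Qed.

Lemma L1_seminorm_triangle u v :
  L1_seminorm (u + v) <= L1_seminorm u + L1_seminorm v.
Proof.
have Lu := H1L1fun_Lfun2 (repr u); have Lv := H1L1fun_Lfun2 (repr v).
rewrite /L1_seminorm -RintegralD//; try exact: normr_integrable.
rewrite (@eq_ae_Rintegral_normr _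
  (fun x => (repr u : H1L1fun r) x + (repr v : H1L1fun r) x)).
- apply: le_Rintegral => //.
  + by apply: normr_integrable; exact: Lfun2D.
  + exact: (integrableD measurableT (normr_integrable Lu) (normr_integrable Lv)).
  + by move=> x _; exact: ler_normD.
- exact: H1L1fun_Lfun2.
- exact: Lfun2D.
have := repr_linear_ae 1 u v; rewrite scale1r.
by apply: filterS => x ->; rewrite mul1r.
Qed.

Lemma L1_seminorm_le u :
  L1_seminorm u ^+ 2 <= fine (mu [set: R3 R]) * H1_inner u u.
Proof.
have Lu := H1L1fun_Lfun2 (repr u).
apply: le_trans (Rintegral_normr_sqr_le (ball_measure_fin r) Lu) _.
rewrite ler_wpM2l ?fine_ge0//; have := inner_jet_le ord0 u.
by rewrite jet0.
Qed.

(** Each component of the jet converges in L^2; the limits of the derivatives are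
    weak derivatives of the limit of the functions. The constant is 4 because
    each of the four components contributes an error of at most 4^-n. *)
Lemma H1L1_complete (u : nat -> H1L1 r) :
  (forall n m, (n <= m)%N ->
    H1_inner (u m - u n) (u m - u n) <= 4^-1 ^+ n) ->
  exists v K, forall n, H1_inner (u n - v) (u n - v) <= K * 4^-1 ^+ n.
Proof.
move=> uc.
have jetc j : exists v, v \in L2 /\
    forall n, ip (jet j (u n) \- v) (jet j (u n) \- v) <= 4^-1 ^+ n.
  have [n|n m nm|v Lv uv] := @L2_complete _ _ _ mu (ball_measure_fin r)
    (fun n => jet j (u n)).
  - exact: jet_Lfun2.
  - apply: le_trans (uc _ _ nm); apply: le_trans (inner_jet_le j _).
    have Lm := jet_Lfun2 j (u m); have Ln := jet_Lfun2 j (u n).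
    rewrite (@eq_ae_inner _ _ _ mu _ (jet j (u m - u n)) _ (jet j (u m - u n)))//.
    + exact: Lfun2B.
    + exact: Lfun2B.
    + exact: jet_Lfun2.
    + exact: jet_Lfun2.
    + by apply: filterS (jet_sub_ae j (u m) (u n)) => x ->.
    + by apply: filterS (jet_sub_ae j (u m) (u n)) => x ->.
  by exists v.
have [v vP] := choice jetc.
pose f := v ord0; pose g i := v (lift ord0 i).
have jetS i w : jet (lift ord0 i) w = weak_partial r i (repr w : H1L1fun r).
  by rewrite /jet liftK.
have wg i : is_weak_partial r i f (g i).
  apply: (@is_weak_partial_closed i f (g i) (fun n => jet ord0 (u n))
    (fun n => jet (lift ord0 i) (u n))).
  - exact: (vP ord0).1.
  - exact: (vP (lift ord0 i)).1.
  - by move=> n; exact: jet_Lfun2.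
  - by move=> n; exact: jet_Lfun2.
  - by move=> n; rewrite jet0 jetS; have [] := weak_partialP i (H1L1fun_H1 (repr (u n))).
  - exact: (vP ord0).2.
  - exact: (vP (lift ord0 i)).2.
have fin : (f : R3 R -> R^o) \in in_H1L1 r.
  apply/andP; split; last first.
    by apply: Lfun_subset12; [exact: ball_measure_fin|exact: (vP ord0).1].
  apply/asboolP; split; first exact: (vP ord0).1.
  by move=> i; exists (g i); [exact: (vP (lift ord0 i)).1|exact: wg].
pose F : H1L1fun r := MkH1L1fun fin.
exists (\pi_(H1L1 r) F)%qT, 4%:R => n.
rewrite /H1_inner mulr_natl -[X in _ *+ X]card_ord -sumr_const ler_sum// => j _.
have Lv := (vP j).1; have Lu := jet_Lfun2 j (u n).
apply: le_trans ((vP j).2 n).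
have jF : {ae mu, forall x, jet j (\pi_(H1L1 r) F)%qT x = v j x}.
  have := @jet_pi_ae F g (fun i => (vP (lift ord0 i)).1) wg j.
  by case: unliftP => [i ->|->].
have E : {ae mu, forall x, jet j (u n - \pi_(H1L1 r) F)%qT x =
    (jet j (u n) \- v j) x}.
  apply: filterS2 (jet_sub_ae j (u n) (\pi_(H1L1 r) F)%qT) jF => x.
  by move=> -> ->.
by rewrite (eq_ae_inner (jet_Lfun2 j _) (jet_Lfun2 j _) _ _ E E)//; exact: Lfun2B.
Qed.

Lemma H1_norm_sqr u : H1_norm r (repr u : H1L1fun r) ^+ 2 = H1_inner u u.
Proof.
have Lw i := (weak_partialP i (H1L1fun_H1 (repr u))).1.
rewrite sqr_sqrtr ?addr_ge0 ?sqr_ge0//.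
rewrite /L_norm !Lnorm2_sqr /H1_inner big_ord_recl jet0; congr (_ + _).
transitivity (\int[mu]_x (\sum_(i < 3)
    (weak_partial r i (repr u : H1L1fun r) x * weak_partial r i (repr u : H1L1fun r) x))).
  apply: eq_Rintegral => x _; rewrite -expr2 sqr_sqrtr//.
  by apply: sumr_ge0 => i _; exact: sqr_ge0.
rewrite /Rintegral; under eq_integral do rewrite -sumEFin.
rewrite integral_sum//; last by move=> i; exact: mul_integrable.
rewrite -sum_fine; last first.
  by move=> i _; exact: (integrable_fin_num measurableT (mul_integrable (Lw i) (Lw i))).
by apply: eq_bigr => i _; rewrite /jet liftK.
Qed.

Lemma H1L1_normE u :
  H1L1_norm u = Num.sqrt (H1_inner u u + L1_seminorm u ^+ 2).
Proof.
rewrite /H1L1_norm H1_norm_sqr; congr (Num.sqrt (_ + _ ^+ 2)).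
by rewrite /L_norm Lnorm1.
Qed.

End SobolevSpace.

Theorem theorem5 (R : realType) (r : R) (hr : 0 < r) :
  exists h : is_norm (@H1L1_norm R r),
    [/\ complete_space (normed h),
        uniformly_convex (normed h) &
        reflexive_space (normed h)].
Proof.
apply: (@hilbertian_banach R (H1L1 r) (@H1_inner R r) (@L1_seminorm R r)
  (fine (ball_measure r [set: R3 R]))).
- exact: H1_inner_sym.
- exact: H1_inner_linear.
- exact: H1_inner_ge0.
- exact: H1_inner_eq0.
- by move=> x; apply: Rintegral_ge0.
- exact: L1_seminorm_triangle.
- exact: L1_seminorm_scale.
- exact: L1_seminorm_le.
- exact: H1L1_complete.
- exact: H1L1_normE.
Qed.
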